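(* There exists an $\widetilde{O}(n^{2/3}+D)$-round randomized algorithm in the $\mathsf{CONGEST}$ model that solves the Replacement Paths (RPaths) problem in unweighted directed graphs with high probability.
   Context: Let $G=(V,E)$ be an unweighted directed graph with $n=|V|$. The communication network is $G$ itself, with communication over each edge in both directions regardless of its orientation; $D$ denotes the diameter of the underlying undirected unweighted graph. In the $\mathsf{CONGEST}$ model, computation proceeds in synchronous rounds; in each round every vertex may send a (possibly different) $O(\log n)$-bit message to each of its neighbours; vertices have unique $O(\log n)$-bit identifiers and unlimited local computation. ''With high probability'' means with probability $1-1/\operatorname{poly}(n)$; $\widetilde{O}$ hides polylogarithmic factors in $n$. Input: vertices $s,t$ and a shortest $s$-$t$ path $P=(s=v_0,v_1,\dots,v_{h_{st}}=t)$, where $h_{st}$ is the number of edges of $P$. Initially, both endpoints of each edge of $P$ know that this edge belongs to $P$, $s$ knows it is the source, and $t$ knows it is the target. For an edge $e$, $|st\diamond e|$ denotes the length (number of edges) of a shortest $s$-$t$ path in $G$ that does not use $e$ ($\infty$ if none exists). The RPaths problem asks that, for every $0\le i<h_{st}$, the vertex $v_i$ computes $|st\diamond (v_i,v_{i+1})|$. *)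

(* Defs.v *)
From mathcomp Require Import all_boot all_order.
Set Implicit Arguments.
Unset Strict Implicit.
Unset Printing Implicit Defensive.

(* adjacency in the communication network = underlying undirected graph *)
Definition uadj n (E : rel 'I_n) : rel 'I_n :=
  fun u v => (u != v) && (E u v || E v u).

Definition walk_from n (E : rel 'I_n) (u : 'I_n) (p : seq 'I_n) (v : 'I_n) : bool :=
  path E u p && (last u p == v).

Definition avoids n (e : 'I_n * 'I_n) (u : 'I_n) (p : seq 'I_n) : bool :=
  all (fun xy => xy != e) (zip (u :: p) p).

Definition is_shortest_path n (E : rel 'I_n) (s : 'I_n) (P : seq 'I_n) (t : 'I_n) : Prop :=
  walk_from E s P t /\ forall p, walk_from E s p t -> size P <= size p.

Definition repl_dist n (E : rel 'I_n) (s t : 'I_n) (e : 'I_n * 'I_n) (d : option nat) : Prop :=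
  match d with
  | Some k => (exists p, [&& walk_from E s p t, avoids e s p & size p == k]) /\
              (forall p, walk_from E s p t -> avoids e s p -> k <= size p)
  | None => forall p, walk_from E s p t -> ~~ avoids e s p
  end.

Definition udiam_le n (E : rel 'I_n) (D : nat) : Prop :=
  forall u v : 'I_n, exists p, [&& path (uadj E) u p, last u p == v & size p <= D].

Definition cbrt_up (m : nat) : nat := find (fun x => m <= x ^ 3) (iota 0 m.+1).

(* Local knowledge of a vertex at time 0 (everything expressed by identifiers) *)
Record local_input := LocalInput {
  li_n : nat;
  li_id : nat;
  li_out_nbrs : seq nat;
  li_in_nbrs : seq nat;
  li_is_s : bool;
  li_is_t : bool;
  li_P_next : option nat;
  li_P_prev : option nat
}.

(* A randomized CONGEST algorithm: arbitrary (unlimited) local computation. *)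
Record congest_alg := CongestAlg {
  St : Type;
  rbits : nat -> nat;                         (* number of random bits per vertex, given n *)
  init : local_input -> seq bool -> St;
  msg : St -> nat -> seq bool;                (* message sent to the neighbour with given id *)
  trans : St -> (nat -> seq bool) -> St;      (* new state from received messages (by sender id) *)
  out : St -> option (option nat)             (* output; None = not yet decided;
                                                 Some None = infinity *)
}.

Definition local_inputs n (E : rel 'I_n) (id : 'I_n -> nat) (s t : 'I_n) (P : seq 'I_n)
  (v : 'I_n) : local_input :=
  let L := s :: P in
  let i := index v L in
  LocalInput n (id v)
    (sort leq [seq id u | u <- enum 'I_n & E v u])
    (sort leq [seq id u | u <- enum 'I_n & E u v])
    (v == s) (v == t)
    (if i < size P then Some (id (nth s L i.+1)) else None)
    (if (0 < i) && (i <= size P) then Some (id (nth s L i.-1)) else None).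

(* state of every vertex after r synchronous rounds; messages are truncated to
   B bits (B = O(log n) bandwidth) and only travel along edges of the network *)
Fixpoint exec (A : congest_alg) n (E : rel 'I_n) (id : 'I_n -> nat)
  (inp : 'I_n -> local_input) (rnd : 'I_n -> seq bool) (B : nat) (r : nat) : 'I_n -> St A :=
  match r with
  | 0 => fun v => @init A (inp v) (rnd v)
  | r'.+1 => fun v =>
      @trans A (exec A E id inp rnd B r' v)
        (fun x => match [pick u | uadj E v u && (id u == x)] with
                  | Some u => take B (@msg A (exec A E id inp rnd B r' u) (id v))
                  | None => [::]
                  end)
  end.

(* vertex v irrevocably outputs a within the first T rounds: the first round at
   which its output is defined is <= T, and the output then is a *)
Definition decided_by (A : congest_alg) n (E : rel 'I_n) (id : 'I_n -> nat)
  (inp : 'I_n -> local_input) (rnd : 'I_n -> seq bool) (B T : nat) (v : 'I_n)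
  (a : option nat) : Prop :=
  exists2 r, r <= T &
    @out A (exec A E id inp rnd B r v) = Some a /\
    forall r', r' < r -> @out A (exec A E id inp rnd B r' v) = None.

(* Main.v *)
(* Let H be G without the edges of P. A shortest s-t path avoiding the i-th edge
   of P follows P to some v_a with a <= i, takes a shortest walk of H to some v_b
   with b > i, and follows P to t. If this detour is short, it is found by
   flooding along H the largest b reachable in d steps, and then by pushing the
   costs of detours along P in lockstep. Otherwise it meets one of the about
   n^(1/3) vertices ("landmarks") sampled with probability about n^(-2/3);
   distances in H from and to landmarks come from source detection with about
   n^(2/3) hops, completed by broadcasting the distances between landmarks. For
   each landmark the best a <= i and b > i are found by pipelined scans inside
   segments of P with about n^(2/3) edges, and broadcasts of one value per
   segment and landmark. *)
From Stdlib Require Import FunctionalExtensionality.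
Require Import Defs.
From mathcomp Require Import all_boot zify.

Set Implicit Arguments.
Unset Strict Implicit.
Unset Printing Implicit Defensive.

(** * Messages, programs and synchronous loops *)

(** All vertices must leave a phase in the same round, so its duration has to be common knowledge.
    Only the broadcasts depend on the unknown [D]; an initial phase gives every vertex the same
    upper bound for it, at most [3 * D.+1]. A broadcast is source detection with the messages as
    labels, so it costs hops plus number of labels. The exponents balance: with x about n^(2/3) hops
    (up to logarithms) there are about n/x landmarks, and both the pairs of landmarks and the pairs
    (segment, landmark) number about (n/x)^2, again n^(2/3). Vertices do not know their index on
    [P], but since [P] is shortest it is their distance from [s]; hence [s] is made a landmark. For
    the same reason a detour of d edges advances by at most d along [P], so short detours need
    pushing over fewer than [hops n] edges. Keeping only the largest b for given a and d is enough:
    the cost falls as b grows, and b > i becomes easier. *)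

Fixpoint bits_fuel (f x : nat) : seq bool :=
  if f is f'.+1 then if x == 0 then [::] else odd x :: bits_fuel f' x./2 else [::].

Definition bits x := bits_fuel x x.

Fixpoint bits_val (bs : seq bool) : nat :=
  if bs is b :: bs' then b + (bits_val bs').*2 else 0.

(** Self-delimiting code: [true] precedes each bit and [false] closes a number, so a number below
    [2 ^ w] takes at most [2 * w + 1] bits and an empty message decodes to no number. *)
Definition enc (l : seq nat) : seq bool :=
  flatten [seq flatten [seq [:: true; b] | b <- bits x] ++ [:: false] | x <- l].

Fixpoint dec (acc bs : seq bool) : seq nat :=
  match bs with
  | true :: b :: bs' => dec (rcons acc b) bs'
  | false :: bs' => bits_val acc :: dec [::] bs'
  | _ => [::]
  end.

Lemma bits_fuelK f x : x <= f -> bits_val (bits_fuel f x) = x.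
Proof.
elim: f x => [|f IH] [|x] //= lxf.
by rewrite IH; [exact: (odd_double_half x.+1) | lia].
Qed.

Lemma bitsK x : bits_val (bits x) = x.
Proof. exact: bits_fuelK. Qed.

Lemma size_bits w x : x < 2 ^ w -> size (bits x) <= w.
Proof.
rewrite /bits; move: {2}x => f; elim: f w x => [|f IH] [|w] [|x] lxw //=.
by apply: IH; rewrite expnS in lxw; lia.
Qed.

Lemma decE acc bs r : dec acc (flatten [seq [:: true; b] | b <- bs] ++ r) = dec (acc ++ bs) r.
Proof. by elim: bs acc => [|b bs IH] acc /=; rewrite ?cats0 // IH cat_rcons. Qed.

Lemma encK : cancel enc (dec [::]).
Proof. by elim=> [|x l IH] //; rewrite /enc /= -catA decE /= bitsK IH. Qed.

Lemma size_enc w l : all (fun x => x < 2 ^ w) l -> size (enc l) <= size l * (2 * w).+1.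
Proof.
elim: l => [|x l IH] //= /andP[lx /IH{}IH].
have -> : enc (x :: l) = (flatten [seq [:: true; b] | b <- bits x] ++ [:: false]) ++ enc l by [].
rewrite mulSn !size_cat; apply: leq_add => //; rewrite /= addn1 ltnS.
have -> : size (flatten [seq [:: true; b] | b <- bits x]) = 2 * size (bits x).
  by elim: (bits x) => //= b bs ->; lia.
by rewrite leq_mul2l size_bits.
Qed.

(** A resumption: the state of a vertex is the rest of its program, and it has decided exactly when
    nothing but [Ret] remains. Phases are chained by [bind]. *)
Inductive prog (X : Type) : Type :=
| Ret (x : X)
| Step (m : seq bool) (k : (nat -> seq bool) -> prog X).

Fixpoint bind X Y (p : prog X) (f : X -> prog Y) : prog Y :=
  match p with
  | Ret x => f x
  | Step m k => Step m (fun recv => bind (k recv) f)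
  end.

Definition pmsg X (p : prog X) : seq bool := if p is Step m _ then m else [::].

Definition pstep X (p : prog X) (recv : nat -> seq bool) : prog X :=
  if p is Step _ k then k recv else p.

Definition pval X (p : prog X) : option X := if p is Ret x then Some x else None.

Definition prog_alg (rb : nat -> nat) (main : local_input -> seq bool -> prog (option nat)) :=
  CongestAlg rb main (fun p _ => pmsg p) (@pstep _) (@pval _).

(* Every phase is a loop in which a vertex broadcasts the same numbers to all
   neighbours and reads only those coming from the identifiers in [nb]. *)
Fixpoint until S (nb : seq nat) (mf : nat -> S -> seq nat) (tr : nat -> S -> seq nat -> S)
    (stop : nat -> S -> bool) (fuel r : nat) (s : S) : prog (nat * S) :=
  if stop r s then Ret (r, s) else
  if fuel is f.+1 then
    Step (enc (mf r s)) (fun recv =>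
      until nb mf tr stop f r.+1 (tr r s (flatten [seq dec [::] (recv x) | x <- nb])))
  else Ret (r, s).

Definition loop S nb mf tr T (s : S) : prog S :=
  bind (until nb mf tr (fun r _ => r == T) T 0 s) (fun rs => Ret rs.2).

Section Network.

Variables (n : nat) (E : rel 'I_n) (id : 'I_n -> nat) (B : nat).
Hypothesis id_inj : injective id.

Definition inbox (ms : 'I_n -> seq bool) (v : 'I_n) : nat -> seq bool :=
  fun x => match [pick u | uadj E v u && (id u == x)] with
           | Some u => take B (ms u)
           | None => [::]
           end.

Definition gstep X (p : 'I_n -> prog X) : 'I_n -> prog X :=
  fun v => pstep (p v) (inbox (fun u => pmsg (p u)) v).

(** Lockstep termination: a vertex returning early would start the next phase while its neighbours
    still read its messages as part of this one. *)
Fixpoint runs X (T : nat) (p : 'I_n -> prog X) (x : 'I_n -> X) : Prop :=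
  if T is T'.+1 then (forall v, ~~ isSome (pval (p v))) /\ runs T' (gstep p) x
  else forall v, p v = Ret (x v).

Lemma eq_runs X T (p q : 'I_n -> prog X) x y : p =1 q -> x =1 y -> runs T p x -> runs T q y.
Proof. by move=> /functional_extensionality -> /functional_extensionality ->. Qed.

(** As nobody returns before round [T1], the messages sent until then are those of the first phase
    alone. *)
Lemma runs_bind X Y T1 T2 (p : 'I_n -> prog X) x (f : 'I_n -> X -> prog Y) y :
  runs T1 p x -> runs T2 (fun v => f v (x v)) y -> runs (T1 + T2) (fun v => bind (p v) (f v)) y.
Proof.
elim: T1 p => [|T1 IH] p /=.
  by move=> px; apply: eq_runs => // v; rewrite px.
case=> pS /IH{}IH /IH{}IH; split=> [v|].
  by case: (p v) (pS v).
apply: eq_runs IH => // v; rewrite /gstep.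
have -> : (fun u => pmsg (bind (p u) (f u))) = (fun u => pmsg (p u)).
  by apply: functional_extensionality => u; case: (p u) (pS u).
by case: (p v) (pS v).
Qed.

Lemma exec_iter rb main inp rnd r :
  exec (prog_alg rb main) E id inp rnd B r = iter r (@gstep _) (fun v => main (inp v) (rnd v)).
Proof.
elim: r => [|r IH] //=; apply: functional_extensionality => v.
by rewrite IH.
Qed.

Lemma runs_decided rb main inp rnd T T' (x : 'I_n -> option nat) v :
  runs T (fun v => main (inp v) (rnd v)) x -> T <= T' ->
  decided_by (prog_alg rb main) E id inp rnd B T' v (x v).
Proof.
move=> runsT leT; exists T => //; rewrite exec_iter; split.
  elim: T {leT} (fun v => _) runsT => [|T IH] p /=; first by move->.
  by case=> _ /IH; rewrite -iterS iterSr.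
move=> r ltrT; rewrite exec_iter -[out _]/(pval _).
elim: T r ltrT {leT} (fun v => _) runsT => [|T IH] [|r] //= ltrT p [].
  by move=> /(_ v); case: (pval _).
by move=> _ runsT; rewrite -iterS iterSr (IH r).
Qed.

Section Loop.

Variables (S : Type) (nb : 'I_n -> seq nat).
Variables (mf : 'I_n -> nat -> S -> seq nat) (tr : 'I_n -> nat -> S -> seq nat -> S).
Variable (stop : 'I_n -> nat -> S -> bool).

Definition received (ms : 'I_n -> seq nat) (v : 'I_n) : seq nat :=
  flatten [seq (if [pick u | id u == x] is Some u then ms u else [::]) | x <- nb v].

(** The loop without encoding, bandwidth and stopping test. Each phase is analysed on [sem] and
    carried over to [runs] by [runs_until]. *)
Fixpoint sem (s0 : 'I_n -> S) (r : nat) : 'I_n -> S :=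
  if r is r'.+1 then
    fun v => tr v r' (sem s0 r' v) (received (fun u => mf u r' (sem s0 r' u)) v)
  else s0.

Lemma mem_received ms v y :
  reflect (exists2 u, id u \in nb v & y \in ms u) (y \in received ms v).
Proof.
apply: (iffP flatten_mapP) => [[x xv]|[u uv yu]].
  by case: pickP => // u /eqP ux yu; exists u; rewrite ?ux.
exists (id u) => //; case: pickP => [w /eqP/id_inj-> //|/(_ u)].
by rewrite eqxx.
Qed.

Hypothesis nb_adj : forall v x, x \in nb v -> exists2 u, uadj E v u & id u = x.

Lemma inbox_received (ms : 'I_n -> seq nat) v : (forall u, size (enc (ms u)) <= B) ->
  flatten [seq dec [::] (inbox (fun u => enc (ms u)) v x) | x <- nb v] = received ms v.
Proof.
move=> msB; congr flatten; apply/eq_in_map => x /nb_adj[u uv <-].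
rewrite /inbox; case: pickP => [w /andP[_ /eqP/id_inj->]|/(_ u)]; last by rewrite uv eqxx.
rewrite take_oversize // encK.
by case: pickP => [w' /eqP/id_inj-> //|/(_ u)]; rewrite eqxx.
Qed.

(** With at most one number of [w] bits per message the truncation to [B] bits loses nothing. The
    test may read the state, as the eccentricity phase requires, provided it succeeds everywhere in
    the same round. *)
Lemma runs_until (s0 : 'I_n -> S) w T fuel :
  T <= fuel -> (2 * w).+1 <= B ->
  (forall r v, r <= T -> stop v r (sem s0 r v) = (r == T)) ->
  (forall r v, r < T -> size (mf v r (sem s0 r v)) <= 1 /\
                        all (fun x => x < 2 ^ w) (mf v r (sem s0 r v))) ->
  runs T (fun v => until (nb v) (mf v) (tr v) (stop v) fuel 0 (s0 v)) (fun v => (T, sem s0 T v)).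
Proof.
move=> leT wB stopP mfP.
suff H d r f : r + d = T -> d <= f ->
  runs d (fun v => until (nb v) (mf v) (tr v) (stop v) f r (sem s0 r v)) (fun v => (T, sem s0 T v)).
  exact: (H T 0 fuel).
elim: d r f => [|d IH] r f rd df.
  rewrite addn0 in rd; rewrite -rd => v.
  by case: f {df} => [|f] /=; rewrite stopP ?rd ?eqxx.
case: f df => // f df /=.
have nstop v : stop v r (sem s0 r v) = false by rewrite stopP; lia.
split=> [v|]; first by rewrite nstop.
have {IH} := IH r.+1 f; rewrite addSnnS => /(_ rd df).
apply: eq_runs => // v; rewrite /gstep nstop /=.
have -> : (fun u => pmsg (if stop u r (sem s0 r u) then Ret (r, sem s0 r u) else
    Step (enc (mf u r (sem s0 r u))) (fun recv =>
      until (nb u) (mf u) (tr u) (stop u) f r.+1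
        (tr u r (sem s0 r u) (flatten [seq dec [::] (recv x) | x <- nb u])))))
    = (fun u => enc (mf u r (sem s0 r u))).
  by apply: functional_extensionality => u; rewrite nstop.
rewrite inbox_received // => u; have [|sz al] := mfP r u; first lia.
apply: leq_trans (size_enc al) (leq_trans _ wB).
by rewrite -[leqRHS]mul1n leq_mul2r sz orbT.
Qed.

End Loop.

Lemma runs_loop S (nb : 'I_n -> seq nat) mf tr (s0 : 'I_n -> S) w T :
  (forall v x, x \in nb v -> exists2 u, uadj E v u & id u = x) ->
  (2 * w).+1 <= B ->
  (forall r v, r < T -> size (mf v r (sem nb mf tr s0 r v)) <= 1 /\
                        all (fun x => x < 2 ^ w) (mf v r (sem nb mf tr s0 r v))) ->
  runs T (fun v => loop (nb v) (mf v) (tr v) T (s0 v)) (sem nb mf tr s0 T).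
Proof.
move=> nbP wB mfP; rewrite -[T in runs T _]addn0.
by apply: runs_bind (runs_until nbP (leqnn T) wB _ mfP) _.
Qed.

End Network.

(** * Walks and source detection *)

Section Walk.

Variables (T : finType) (R : rel T).

Fixpoint walk (d : nat) (u v : T) : bool :=
  if d is d'.+1 then [exists w, walk d' u w && R w v] else u == v.

Lemma walkS d u w v : walk d u w -> R w v -> walk d.+1 u v.
Proof. by move=> uw wv /=; apply/existsP; exists w; rewrite uw. Qed.

Lemma walk_inv d u v : walk d.+1 u v -> exists2 w, walk d u w & R w v.
Proof. by case/existsP=> w /andP[uw wv]; exists w. Qed.

Lemma walkD a b u w v : walk a u w -> walk b w v -> walk (a + b) u v.
Proof.
move=> uw; elim: b v => [|b IH] v; first by rewrite addn0 => /eqP <-.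
by rewrite addnS => /walk_inv[z /IH uz zv]; apply: walkS uz zv.
Qed.

Lemma walk_split a b u v : walk (a + b) u v -> exists2 w, walk a u w & walk b w v.
Proof.
elim: b v => [|b IH] v; first by rewrite addn0; exists v => //=.
rewrite addnS => /walk_inv[z /IH[w uw wz] zv].
by exists w => //; apply: walkS wz zv.
Qed.

Lemma walk_pathP d u v :
  reflect (exists p, [/\ path R u p, last u p = v & size p = d]) (walk d u v).
Proof.
apply: (iffP idP) => [|[p [pp pv <-]]].
  elim: d v => [|d IH] v; first by move=> /eqP <-; exists [::].
  move=> /walk_inv[w /IH[p [pp pw szp]] wv]; exists (rcons p v).
  by rewrite rcons_path last_rcons size_rcons pp pw wv szp.
elim/last_ind: p v pp pv => [|p w IH] v /=; first by move=> _ ->.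
rewrite rcons_path last_rcons size_rcons => /andP[pp pw <-].
exact: walkS (IH _ pp erefl) pw.
Qed.

End Walk.

Lemma eq_walk (T : finType) (R R' : rel T) : R =2 R' -> forall d, walk R d =2 walk R' d.
Proof.
move=> eR; elim=> [|d IH] u v //=; apply: eq_existsb => w.
by rewrite IH eR.
Qed.

Lemma walk_rev (T : finType) (R : rel T) d u v :
  walk (fun x y => R y x) d u v = walk R d v u.
Proof.
have H (Q : rel T) a x y : walk (fun x y => Q y x) a x y -> walk Q a y x.
  elim: a y => [|a IH] y; first by rewrite /= eq_sym.
  case/walk_inv=> w /IH wx yw; apply: (@walkD _ _ 1 a) wx.
  by apply: walkS yw; rewrite /=.
by apply/idP/idP; [apply: H | apply: (H (fun x y => R y x))].
Qed.

Lemma sub_count_lt (T : eqType) (a b : pred T) s x :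
  subpred a b -> x \in s -> b x -> ~~ a x -> count a s < count b s.
Proof.
move=> sab xs bx nax; elim: s xs => //= y s IH; rewrite inE.
case: eqVneq => [<- _|_ /= /IH lts].
  by rewrite bx (negbTE nax) ltnS sub_count.
by rewrite -addnS leq_add //; case: (boolP (a y)) => // /sab ->.
Qed.

(** The keys known and the keys already sent. *)
Definition sd_state := (seq nat * seq nat)%type.

Definition sd_cand (W : nat) (st : sd_state) : seq nat :=
  [seq k <- st.1 | (k \notin st.2) && all (fun k' => (k' %% W == k %% W) ==> (k <= k')) st.1].

Definition sd_msg (W r : nat) (st : sd_state) : seq nat := take 1 (sort leq (sd_cand W st)).

Definition sd_trans (W r : nat) (st : sd_state) (xs : seq nat) : sd_state :=
  (st.1 ++ [seq x + W | x <- xs], sd_msg W r st ++ st.2).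

Definition sd (nb : seq nat) W T (l : seq nat) : prog (seq nat) :=
  bind (loop nb (sd_msg W) (sd_trans W) T (l, [::])) (fun st => Ret st.1).

Lemma take1_sort (s : seq nat) x : x \in s ->
  exists2 m, take 1 (sort leq s) = [:: m] & m \in s /\ {in s, forall y, m <= y}.
Proof.
rewrite -(mem_sort leq) => xs; have := sort_sorted leq_total s.
have := mem_sort leq s; case: (sort leq s) xs => // m s' _ ms sm.
exists m; first by rewrite /= take0.
rewrite -ms inE eqxx; split=> // y.
rewrite -ms inE => /predU1P[->//|ys].
by have /allP := order_path_min leq_trans sm; apply.
Qed.

(* Lenzen-Peleg source detection.  A pair (distance, label) is coded by the key
   [distance * W + label], so that the lexicographic order on pairs is the order
   of keys and crossing an edge adds [W].  A key which is tight (smallest for its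
   label) at [v] is sent by [v] by round [distance + rank], where the rank counts
   the labels having a smaller key at [v]: ranks do not decrease along edges. *)
Section SourceDetection.

Variables (n : nat) (id : 'I_n -> nat) (nb : 'I_n -> seq nat).
Hypothesis id_inj : injective id.
Variables (W : nat) (lab : 'I_n -> seq nat) (Lab : seq nat).
Hypothesis labP : forall v l, l \in lab v -> l \in Lab /\ l < W.

Definition arc : rel 'I_n := fun u v => id u \in nb v.

Definition sd_true k v := [exists u, (k %% W \in lab u) && walk arc (k %/ W) u v].

Definition sd_tight k v :=
  sd_true k v && [forall k' : 'I_k, (k' %% W == k %% W) ==> ~~ sd_true k' v].

Definition sd_rank k v :=
  count (fun l => [exists k' : 'I_k, (k' %% W == l) && sd_true k' v]) Lab.

Lemma sd_true_W k v : sd_true k v -> 0 < W.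
Proof. by case/existsP=> u /andP[/labP[_]]; case: W. Qed.

Lemma sd_true_arc k u v : arc u v -> sd_true k u -> sd_true (k + W) v.
Proof.
move=> uv ku; have W0 := sd_true_W ku; case/existsP: ku => w /andP[wl uw].
apply/existsP; exists w; rewrite modnDr wl divnDr // divnn W0 addn1.
exact: walkS uw uv.
Qed.

Lemma sd_true_inv k v : sd_true k v -> W <= k -> exists2 u, arc u v & sd_true (k - W) u.
Proof.
move=> kv Wk; have W0 := sd_true_W kv; case/existsP: kv => w /andP[wl].
rewrite -{1}(subnK Wk) divnDr // divnn W0 addn1 => /walk_inv[u wu uv].
by exists u => //; apply/existsP; exists w; rewrite wu -(modnDr _ W) subnK ?wl.
Qed.

Lemma sd_tight_exists k v : sd_true k v ->
  exists2 k', k' <= k & sd_tight k' v /\ k' %% W = k %% W.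
Proof.
elim/ltn_ind: k => k IH kv; case: (boolP (sd_tight k v)) => [kt|]; first by exists k.
rewrite negb_and kv => /forallPn[[k' ltk] /=]; rewrite negb_imply negbK => /andP[/eqP e k'v].
have [k2 le2 [k2t e2]] := IH _ ltk k'v.
by exists k2; [apply: leq_trans le2 (ltnW ltk) | rewrite e2].
Qed.

Lemma sd_tight_min k k' v : sd_tight k v -> sd_true k' v -> k' %% W = k %% W -> k <= k'.
Proof.
move=> /andP[_ /forallP H] k'v e; rewrite leqNgt; apply/negP => lt.
by have := H (Ordinal lt); rewrite /= e eqxx k'v.
Qed.

Lemma sd_rank_lt k1 k2 v : sd_tight k1 v -> k1 < k2 -> sd_rank k1 v < sd_rank k2 v.
Proof.
move=> k1t lt12; have k1v : sd_true k1 v by case/andP: k1t.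
apply: (@sub_count_lt _ _ _ _ (k1 %% W)) => [l /existsP[k /andP[kl kv]]| | |].
- by apply/existsP; exists (widen_ord (ltnW lt12) k); rewrite /= kl.
- by case/existsP: k1v => u /andP[/labP[]].
- by apply/existsP; exists (Ordinal lt12); rewrite /= eqxx.
apply/existsPn => -[k ltk] /=; apply/negP => /andP[/eqP e kv].
by have := sd_tight_min k1t kv e; rewrite leqNgt ltk.
Qed.

Lemma sd_rank_arc k u v : arc u v -> sd_rank k u <= sd_rank (k + W) v.
Proof.
move=> uv; apply: sub_count => l /existsP[[k' lt] /= /andP[kl kv]].
have lt' : k' + W < k + W by rewrite ltn_add2r.
by apply/existsP; exists (Ordinal lt'); rewrite /= modnDr kl (sd_true_arc uv).
Qed.

Let st := sem id nb (fun _ => sd_msg W) (fun _ => sd_trans W) (fun v => (lab v, [::])).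

Lemma st_sent r v : (st r.+1 v).2 = sd_msg W r (st r v) ++ (st r v).2.
Proof. by []. Qed.

Lemma sd_known_mono r r' v k : r <= r' -> k \in (st r v).1 -> k \in (st r' v).1.
Proof.
move=> /subnKC <-; elim: (r' - r) => [|d IH]; rewrite ?addn0 // => /IH.
by rewrite addnS /= mem_cat => ->.
Qed.

Lemma sd_sound r v k : k \in (st r v).1 -> sd_true k v.
Proof.
elim: r v k => [|r IH] v k /=.
  move=> kl; have [_ kW] := labP kl; apply/existsP; exists v.
  by rewrite modn_small // kl divn_small //=.
rewrite mem_cat => /orP[/IH//|/mapP[x /(mem_received id_inj)[u uv xu] ->]].
apply: sd_true_arc uv (IH _ _ _).
by move/mem_take: xu; rewrite mem_sort mem_filter => /andP[].
Qed.

Lemma sd_sent_known r v k : k \in (st r v).2 -> k \in (st r v).1.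
Proof.
elim: r v k => [|r IH] v k //=; rewrite !mem_cat => /orP[|/IH ->//].
by move/mem_take; rewrite mem_sort mem_filter => /andP[_ ->].
Qed.

Lemma sd_sent_arc r u v k : arc u v -> k \in (st r u).2 -> k + W \in (st r v).1.
Proof.
move=> uv; elim: r => [|r IH] //=; rewrite !mem_cat => /orP[ku|/IH-> //].
apply/orP; right; apply: map_f; apply/(mem_received id_inj).
by exists u.
Qed.

Lemma sd_progress r v k : sd_tight k v ->
  (k %/ W + sd_rank k v <= r -> k \in (st r v).1) /\
  (k %/ W + sd_rank k v < r -> k \in (st r v).2).
Proof.
elim: r v k => [|r IH] v k kt; have kv : sd_true k v by case/andP: kt.
  split=> //; rewrite leqn0 addn_eq0 => /andP[/eqP k0 _].
  have {kv} := kv; rewrite /sd_true k0 => /existsP[u /andP[kl /eqP e]].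
  have -> : k = k %% W by rewrite {1}(divn_eq k W) k0.
  by rewrite /= -e.
have sent w j : sd_tight j w -> j %/ W + sd_rank j w <= r -> j \in (st r.+1 w).2.
  move=> jt jr; rewrite st_sent mem_cat; have [/(_ jr) jk _] := IH _ _ jt.
  case: (boolP (j \in (st r w).2)) => [_|jns]; first exact: orbT.
  have jc : j \in sd_cand W (st r w).
    rewrite mem_filter jns jk andbT; apply/allP => k' /sd_sound k't.
    by apply/implyP => /eqP; apply: (sd_tight_min jt k't).
  rewrite orbF /sd_msg; have [m -> [mc mmin]] := take1_sort jc.
  (* Suppose a smaller candidate [m] is sent instead of [j]. The tight key [m'] of its label has a
     smaller rank than [j], so by induction it has been sent before; a candidate is least for its
     label, so [m = m'], which contradicts that [m] is unsent. *)
  have := mmin _ jc; rewrite leq_eqVlt => /predU1P[->|ltmj]; first by rewrite inE.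
  move: mc; rewrite mem_filter => /andP[/andP[mns /allP mall] mk].
  have [m' lem' [m't e]] := sd_tight_exists (sd_sound mk).
  have [_ sent_m'] := IH _ _ m't; have m's : m' \in (st r w).2.
    apply: sent_m'; apply: leq_trans jr; rewrite -addnS leq_add //.
      by apply: leq_div2r; apply: leq_trans lem' (ltnW ltmj).
    by apply: sd_rank_lt m't _; apply: leq_ltn_trans ltmj.
  have /implyP := mall _ (sd_sent_known m's); rewrite e eqxx => /(_ isT).
  move=> lem; have em : m = m' by apply/eqP; rewrite eqn_leq lem.
  by rewrite em m's in mns.
split; last by rewrite ltnS; apply: sent.
case: (leqP W k) => [Wk kr|kW _]; last first.
  apply: (@sd_known_mono 0) => //; have {kv} := kv.
  by rewrite /sd_true divn_small // modn_small // => /existsP[u /andP[kl /eqP <-]].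
have [u uv ku] := sd_true_inv kv Wk; have W0 := sd_true_W kv.
(* A smaller key of this label at [u] would, after adding [W], beat [k] at [v]. *)
have kut : sd_tight (k - W) u.
  rewrite /sd_tight ku; apply/forallP => -[k' lt] /=; apply/implyP => /eqP e.
  apply/negP => /(sd_true_arc uv) /(sd_tight_min kt).
  by rewrite modnDr e -(modnDr (k - W)) subnK // => /(_ erefl); rewrite leqNgt; lia.
rewrite -(subnK Wk); apply: (sd_sent_arc uv (sent _ _ kut _)).
have := sd_rank_arc (k - W) uv; rewrite subnK // => le.
move: kr; rewrite -{1}(subnK Wk) divnDr // divnn W0 addn1 addSn ltnS.
by apply: leq_trans; rewrite leq_add2l.
Qed.

Lemma sd_complete r v k : sd_true k v -> k %/ W + size Lab <= r ->
  exists2 k', k' <= k & k' \in (st r v).1 /\ k' %% W = k %% W.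
Proof.
move=> kv kr; have [k' le [k't e]] := sd_tight_exists kv; exists k' => //; split=> //.
have [+ _] := @sd_progress r _ _ k't; apply; apply: leq_trans kr.
by apply: leq_add; [apply: leq_div2r | apply: count_size].
Qed.

Lemma sd_key_bound r v k : k \in (st r v).1 -> k < W * r.+1.
Proof.
elim: r v k => [|r IH] v k /=; first by rewrite muln1 => /labP[].
rewrite mem_cat => /orP[/IH/leq_trans-> //|]; first by rewrite leq_mul2l leqnSn orbT.
move=> /mapP[x /(mem_received id_inj)[u uv xu] ->].
have /IH : x \in (st r u).1.
  by move/mem_take: xu; rewrite mem_sort mem_filter => /andP[].
by rewrite [W * r.+2]mulnS addnC ltn_add2l.
Qed.

Lemma sd_msg_ok r v w : W * r.+1 <= 2 ^ w ->
  size (sd_msg W r (st r v)) <= 1 /\ all (fun x => x < 2 ^ w) (sd_msg W r (st r v)).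
Proof.
move=> le; split; first by rewrite size_take; case: ifP; lia.
apply/allP => x /mem_take; rewrite mem_sort mem_filter => /andP[_ /sd_key_bound].
by move=> h; apply: leq_trans h le.
Qed.

End SourceDetection.

Section SourceDetectionRuns.

Variables (n : nat) (E : rel 'I_n) (id : 'I_n -> nat) (B : nat) (nb : 'I_n -> seq nat).
Hypothesis id_inj : injective id.
Hypothesis nb_adj : forall v x, x \in nb v -> exists2 u, uadj E v u & id u = x.

(* Keys [d * W + l] returned at [v] witness a walk of length [d] from a holder of
   [l]; conversely short walks are detected, possibly through a smaller key. *)
Definition sd_spec W (lab : 'I_n -> seq nat) D (K : 'I_n -> seq nat) : Prop :=
  (forall v k, k \in K v -> exists2 u, k %% W \in lab u & walk (arc id nb) (k %/ W) u v) /\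
  (forall u v l d, l \in lab u -> walk (arc id nb) d u v -> d <= D ->
     exists2 d', d' <= d & d' * W + l \in K v).

(** Used in two ways: with landmark identifiers as labels it measures distances; with tokens as
    labels and all neighbours as arcs it is a broadcast, of which only the labels are kept. *)
Lemma runs_sd W lab (Lab : seq nat) D T w :
  (forall v l, l \in lab v -> l \in Lab /\ l < W) ->
  D + size Lab <= T -> (2 * w).+1 <= B -> W * T <= 2 ^ w ->
  exists2 K, runs E id B T (fun v => sd (nb v) W T (lab v)) K & sd_spec W lab D K.
Proof.
move=> labP DT wB WT.
pose st := sem id nb (fun _ => sd_msg W) (fun _ => sd_trans W) (fun v => (lab v, [::])).
exists (fun v => (st T v).1).
  rewrite -[T in runs _ _ _ T]addn0; apply: (@runs_bind _ _ _ _ _ _ T 0 _ (st T)) => //.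
  apply: (runs_loop id_inj nb_adj wB) => r v lt.
  apply: (@sd_msg_ok _ _ nb id_inj _ _ _ labP r v w); apply: leq_trans WT.
  by rewrite leq_mul2l lt orbT.
split=> [v k /(sd_sound id_inj labP)/existsP[u /andP[ku kw]]|u v l d lu uv dD].
  by exists u.
have [_ lW] := labP _ _ lu; have W0 : 0 < W by case: (W) lW.
have tr : sd_true id nb W lab (d * W + l) v.
  apply/existsP; exists u; rewrite modnMDl modn_small // lu.
  by rewrite divnMDl // divn_small // addn0.
have [] := sd_complete id_inj labP (r := T) tr.
  by rewrite divnMDl // divn_small // addn0; apply: leq_trans DT; rewrite leq_add2r.
move=> k' le [kK e]; exists (k' %/ W).
  by rewrite -(leq_pmul2r W0); move: le; rewrite {1}(divn_eq k' W) e modnMDl (modn_small lW) leq_add2r.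
by rewrite modnMDl (modn_small lW) in e; rewrite -e -divn_eq.
Qed.

End SourceDetectionRuns.

(** * Pipelines and the eccentricity of the source *)

Lemma walk_shorten (T : finType) (R : rel T) d u v :
  walk R d u v -> exists2 d', d' <= d /\ d' < #|T| & walk R d' u v.
Proof.
case/walk_pathP=> p [pp <- <-]; case/shortenP: pp => q qp uq sq.
exists (size q); last by apply/walk_pathP; exists q.
split; first exact: uniq_leq_size (subseq_uniq (subseq_cons _ _) uq) sq.
by have /card_uniqP/= <- := uq; apply: max_card.
Qed.

Lemma foldr_minn_le INF (s : seq nat) x : x \in s -> foldr minn INF s <= x.
Proof. by elim: s => //= y s IH; rewrite inE => /predU1P[->|/IH]; lia. Qed.

Lemma foldr_minn_in INF (s : seq nat) : foldr minn INF s < INF -> foldr minn INF s \in s.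
Proof.
elim: s => [|y s IH] /=; first by rewrite ltnn.
rewrite inE; case: (leqP y (foldr minn INF s)) => [_|_ /IH ->]; last exact: orbT.
by rewrite eqxx.
Qed.

Lemma foldr_minn_le_inf INF (s : seq nat) : foldr minn INF s <= INF.
Proof. by elim: s => //= y s IH; rewrite geq_min IH orbT. Qed.

Lemma foldr_minn_cases x (s : seq nat) : foldr minn x s = x \/ foldr minn x s \in s.
Proof.
have := foldr_minn_le_inf x s; rewrite leq_eqVlt => /predU1P[|/foldr_minn_in]; first by left.
by right.
Qed.

Lemma foldr_maxn_ge (s : seq nat) x : x \in s -> x <= foldr maxn 0 s.
Proof. by elim: s => //= y s IH; rewrite inE => /predU1P[->|/IH]; lia. Qed.

Lemma foldr_maxn_in (s : seq nat) : 0 < foldr maxn 0 s -> foldr maxn 0 s \in s.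
Proof.
elim: s => [|y s IH] //=; rewrite inE.
by case: (leqP (foldr maxn 0 s) y) => [_|_ /IH ->]; rewrite ?eqxx ?orbT.
Qed.

(* The state [z] is the history of the minima received, one entry per round. *)
Definition pipe_msg INF (c : nat -> nat) r (z : seq nat) : seq nat :=
  [:: minn (c r) (nth INF z r)].

Definition pipe_trans INF (r : nat) (z xs : seq nat) : seq nat := rcons z (foldr minn INF xs).

Definition pipe nb INF c T : prog (seq nat) :=
  loop nb (pipe_msg INF c) (pipe_trans INF) T [:: INF].

Section Pipe.

Variables (n : nat) (E : rel 'I_n) (id : 'I_n -> nat) (B : nat) (nb : 'I_n -> seq nat).
Hypothesis id_inj : injective id.
Hypothesis nb_adj : forall v x, x \in nb v -> exists2 u, uadj E v u & id u = x.
Variables (INF : nat) (c : 'I_n -> nat -> nat).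

(** What [u] injects in round [r - d] arrives [d] arcs further in round [r]. The case [d = 0] is
    left out: the history excludes the vertex's own entry, which [pipe_val] adds where it is
    wanted. *)
Definition pipe_spec T (z : 'I_n -> seq nat) : Prop :=
  (forall r v, r <= T -> nth INF (z v) r < INF ->
     exists u d, [/\ 0 < d <= r, walk (arc id nb) d u v & nth INF (z v) r = c u (r - d)]) /\
  (forall r u v d, r <= T -> 0 < d <= r -> walk (arc id nb) d u v ->
     nth INF (z v) r <= c u (r - d)).

Definition pipe_val (z : 'I_n -> seq nat) v r := minn (c v r) (nth INF (z v) r).

Lemma pipe_val_sound T z r v : pipe_spec T z -> r <= T -> pipe_val z v r < INF ->
  exists u d, [/\ d <= r, walk (arc id nb) d u v & pipe_val z v r = c u (r - d)].
Proof.
move=> [zS _] rT; rewrite /pipe_val; case: (leqP (c v r)) => _ lt.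
  by exists v, 0; rewrite subn0 /=.
by have [u [d [/andP[_ dr] w e]]] := zS _ _ rT lt; exists u, d.
Qed.

Lemma pipe_val_complete T z r u v d : pipe_spec T z -> r <= T -> d <= r ->
  walk (arc id nb) d u v -> pipe_val z v r <= c u (r - d).
Proof.
move=> [_ zC] rT; rewrite /pipe_val geq_min; case: d => [|d] dr.
  by move=> /eqP ->; rewrite subn0 leqnn.
by move=> w; rewrite (zC _ _ _ _ rT _ w) ?orbT.
Qed.

Let sm := sem id nb (fun v => pipe_msg INF (c v)) (fun _ => pipe_trans INF) (fun _ => [:: INF]).

Lemma size_pipe r v : size (sm r v) = r.+1.
Proof. by elim: r v => [|r IH] v //=; rewrite size_rcons IH. Qed.

Lemma pipe_stable r r' v : r <= r' -> nth INF (sm r' v) r = nth INF (sm r v) r.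
Proof.
move=> /subnKC <-; elim: (r' - r) => [|d IH]; first by rewrite addn0.
by rewrite addnS /= nth_rcons size_pipe ltnS leq_addr.
Qed.

Lemma pipe_next r v : nth INF (sm r.+1 v) r.+1 =
  foldr minn INF (received id nb (fun u => [:: minn (c u r) (nth INF (sm r u) r)]) v).
Proof. by rewrite /= nth_rcons size_pipe ltnn eqxx. Qed.

Lemma runs_pipe T w : (2 * w).+1 <= B -> INF < 2 ^ w ->
  exists2 z, runs E id B T (fun v => pipe (nb v) INF (c v) T) z & pipe_spec T z.
Proof.
move=> wB Iw; exists (sm T).
  apply: (runs_loop id_inj nb_adj wB) => r v lt /=; split=> //.
  rewrite andbT; apply: leq_ltn_trans Iw; rewrite geq_min; apply/orP; right.
  case: r {lt} => [|r] //; rewrite pipe_next; exact: foldr_minn_le_inf.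
split=> [r v rT|r u v d rT]; rewrite pipe_stable //; clear T rT.
  elim: r v => [|r IH] v; first by rewrite /= ltnn.
  rewrite pipe_next => lt; have := foldr_minn_in lt; move: (foldr _ _ _) lt => m lt.
  move=> /(mem_received id_inj)[u uv]; rewrite inE => /eqP em.
  move: em; case: (leqP (c u r)) => _ em.
    by exists u, 1; rewrite subSS subn0; split=> //; apply: walkS uv; rewrite /=.
  move: (IH u); rewrite -em => /(_ lt) [u' [d [/andP[d0 dr] wk ->]]]; exists u', d.+1.
  by rewrite subSS; split=> //; apply: walkS wk uv.
elim: r v d => [|r IH] v [|d] // dr /walk_inv[u' wu' uv]; rewrite pipe_next subSS.
have le : minn (c u' r) (nth INF (sm r u') r) <= c u (r - d).
  rewrite geq_min; case: d dr wu' => [|d] dr; first by move=> /eqP->; rewrite subn0 leqnn.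
  by move=> wu'; rewrite (IH u' d.+1) ?orbT.
apply: leq_trans le; apply: foldr_minn_le; apply/(mem_received id_inj).
by exists u'; rewrite ?inE.
Qed.

End Pipe.

Definition ecc_msg (r M : nat) : seq nat := if M is 0 then [::] else [:: M].

(** A vertex first reached in round [r] has depth [r.+1], whence [r.+2]. *)
Definition ecc_trans (r M : nat) (xs : seq nat) : nat :=
  if (M == 0) && (xs == [::]) then 0
  else maxn (if M is 0 then r.+2 else M) (foldr maxn 0 xs).

Definition ecc_stop (r M : nat) : bool := [&& 3 %| r, 0 < M & M <= r %/ 3].

(* [M] is one plus the largest depth heard of (0 before the first message).  If
   some vertex has depth [x] then every vertex reached by round [3 x] knows of a
   depth at least [x] by then, so [M <= x] in round [3 x] means that [x] exceeds
   the eccentricity of the source; all vertices notice this in the same round. *)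
Definition ecc_prog (nb : seq nat) (fuel : nat) (is_s : bool) : prog nat :=
  bind (until nb ecc_msg ecc_trans ecc_stop fuel 0 (nat_of_bool is_s)) (fun rM => Ret rM.1).

Section Ecc.

Variables (n : nat) (E : rel 'I_n) (id : 'I_n -> nat) (B : nat) (nb : 'I_n -> seq nat).
Hypothesis id_inj : injective id.
Hypothesis nb_adj : forall v x, x \in nb v -> exists2 u, uadj E v u & id u = x.
Variable s : 'I_n.
Hypothesis arc_sym : symmetric (arc id nb).
Hypothesis arc_conn : forall v, exists d, walk (arc id nb) d s v.

Let dep v := ex_minn (arc_conn v).

Lemma dep_walk v : walk (arc id nb) (dep v) s v.
Proof. by rewrite /dep; case: ex_minnP. Qed.

Lemma dep_min v d : walk (arc id nb) d s v -> dep v <= d.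
Proof. by rewrite /dep; case: ex_minnP => m _; apply. Qed.

Lemma dep_lt v : dep v < n.
Proof.
have [d [le lt] w] := walk_shorten (dep_walk v); apply: leq_ltn_trans (dep_min w) _.
by rewrite card_ord in lt.
Qed.

Let M := sem id nb (fun _ => ecc_msg) (fun _ => ecc_trans) (fun v => nat_of_bool (v == s)).

Lemma ecc_rcv r v x :
  reflect (exists2 u, arc id nb u v & 0 < M r u /\ x = M r u)
    (x \in received id nb (fun u => ecc_msg r (M r u)) v).
Proof.
apply: (iffP (mem_received id_inj _ _ _ _)) => -[u uv].
  by rewrite /ecc_msg; case e: (M r u) => [|m] //; rewrite inE => /eqP ->; exists u => //; rewrite e.
by case; case e: (M r u) => [|m] // _ ->; exists u => //; rewrite e inE.
Qed.

Lemma ecc_unreached r v : (M r v == 0) = (r < dep v).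
Proof.
elim: r v => [|r IH] v.
  rewrite /M /= eqb0; apply/idP/idP => [vs|]; last first.
    by case: eqP => // ->; have /= := @dep_min s 0; rewrite eqxx => /(_ isT); lia.
  case e: (dep v) => //; have := dep_walk v; rewrite e /= => /eqP es.
  by rewrite es eqxx in vs.
have -> : M r.+1 v = ecc_trans r (M r v) (received id nb (fun u => ecc_msg r (M r u)) v) by [].
rewrite /ecc_trans; set xs := received _ _ _ _.
have -> : ((if (M r v == 0) && (xs == [::]) then 0 else
    maxn (if M r v is 0 then r.+2 else M r v) (foldr maxn 0 xs)) == 0)
    = (M r v == 0) && (xs == [::]).
  by case: ifP => // _; case: (M r v) => *; lia.
rewrite IH; apply/andP/idP => [[lt /eqP xs0]|lt]; last first.
  split; first lia; case e: xs => [//|x xs']; have : x \in xs by rewrite e inE eqxx.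
  case/ecc_rcv=> u uv [Mu _].
  have := IH u; rewrite eqn0Ngt Mu => /esym/negbT; rewrite -leqNgt => du.
  by have := dep_min (walkS (dep_walk u) uv); lia.
rewrite ltn_neqAle lt andbT; apply/eqP => e; have := dep_walk v.
rewrite -e => /walk_inv[u wu uv]; have du := dep_min wu.
suff : M r u \in xs by rewrite xs0.
apply/ecc_rcv; exists u => //; split=> //.
by rewrite lt0n IH; lia.
Qed.

Lemma ecc_new r v : M r v = 0 -> M r.+1 v <> 0 -> dep v = r.+1.
Proof.
move=> /eqP; rewrite ecc_unreached => lt /eqP; rewrite ecc_unreached; lia.
Qed.

Lemma ecc_sound r v : 0 < M r v -> exists w, M r v = (dep w).+1.
Proof.
elim: r v => [|r IH] v.
  rewrite /M /=; case: eqP => // _ _; exists s.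
  by have /= := @dep_min s 0; rewrite eqxx => /(_ isT); case: (dep s).
move=> pos; have new := @ecc_new r v.
have e : M r.+1 v = ecc_trans r (M r v) (received id nb (fun u => ecc_msg r (M r u)) v) by [].
move: e; rewrite /ecc_trans; set xs := received _ _ _ _.
case: ifP => _ e; first by rewrite e in pos.
have [le|lt] := leqP (foldr maxn 0 xs) (if M r v is 0 then r.+2 else M r v).
  rewrite e (maxn_idPl le); case: (posnP (M r v)) => [M0|Mpos]; last first.
    by have [w ew] := IH _ Mpos; exists w; rewrite ew.
  by exists v; rewrite M0 (new M0) //; lia.
rewrite e (maxn_idPr (ltnW lt)).
have : foldr maxn 0 xs \in xs by apply: foldr_maxn_in; apply: leq_ltn_trans lt.
by case/ecc_rcv=> u uv [Mu ->]; apply: IH.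
Qed.

Lemma ecc_complete r v w d : walk (arc id nb) d w v -> dep w + d <= r -> dep w < M r v.
Proof.
elim: r v d => [|r IH] v d wv le.
  have d0 : d = 0 by lia.
  have w0 : dep w = 0 by lia.
  move: wv (dep_walk w); rewrite d0 w0 => /eqP <- /eqP <-.
  by rewrite /M /= eqxx.
have new := @ecc_new r v.
have e : M r.+1 v = ecc_trans r (M r v) (received id nb (fun u => ecc_msg r (M r u)) v) by [].
move: e (ecc_unreached r.+1 v); rewrite /ecc_trans; set xs := received _ _ _ _.
have dv : dep v <= r.+1 by apply: leq_trans le; apply: dep_min (walkD (dep_walk w) wv).
case: ifP => _ e un; first by rewrite e eqxx ltnNge dv in un.
rewrite e leq_max; case: d wv le => [/eqP wv|d /walk_inv[u wu uv]] le; last first.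
  apply/orP; right; apply: (@leq_trans (M r u)); first by apply: (IH u d) => //; lia.
  apply: foldr_maxn_ge; apply/ecc_rcv; exists u => //; split=> //.
  by rewrite lt0n ecc_unreached -leqNgt; have := dep_min (walkD (dep_walk w) wu); lia.
subst w; apply/orP; left; case em: (M r v) => [|m] //; rewrite -em; apply: (IH v 0) => //=.
by rewrite addn0 leqNgt -ecc_unreached em.
Qed.

Definition ecc_radius := 3 * (\max_v dep v).+1.

Lemma ecc_stopE r v : r <= ecc_radius -> ecc_stop r (M r v) = (r == ecc_radius).
Proof.
move=> le; rewrite /ecc_stop; case: (boolP (3 %| r)) => [/dvdnP[x er]|nd] /=; last first.
  by apply/esym/negbTE; apply: contra nd => /eqP ->; apply: dvdn_mulr.
have -> : r %/ 3 = x by rewrite er mulnK.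
have -> : (r == ecc_radius) = (x == (\max_v dep v).+1) by rewrite er /ecc_radius; lia.
apply/idP/eqP => [/andP[pos Mx]|ex].
  have xe : x <= (\max_v dep v).+1 by move: le; rewrite er /ecc_radius; lia.
  apply/eqP; rewrite eqn_leq xe /= ltnNge; apply/negP => xm.
  have dv : dep v <= r by rewrite leqNgt -ecc_unreached -lt0n.
  have [w ew] : exists w, \max_v dep v = dep w.
    by have [|w ew] := @eq_bigmax _ dep; [apply/card_gt0P; exists s | exists w].
  (* If [v] is not deep enough itself, take [y] at depth [x] on a shortest walk to a deepest vertex:
     its depth travels through the source and reaches [v] by round [x + x + dep v <= 3 * x]. Either
     way [M r v] exceeds [x], against the stopping test. *)
  have [y [yx wy]] : exists y, x <= dep y /\ dep y < M r v.
    case: (leqP x (dep v)) => [xv|vx].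
      by exists v; split=> //; apply: (@ecc_complete r v v 0) => //=; lia.
    move: (dep_walk w); rewrite -ew -(subnKC xm) => /walk_split[y sy yw].
    have dy := dep_min sy; have := dep_min (walkD (dep_walk y) yw).
    rewrite -ew => le2; have xy : x <= dep y.
      by rewrite -(leq_add2r (\max_v dep v - x)) subnKC.
    exists y; split=> //.
    apply: (@ecc_complete r v y (dep y + dep v)); last by lia.
    by apply: walkD (dep_walk v); rewrite -walk_rev (@eq_walk _ _ (arc id nb)) ?dep_walk //.
  lia.
have le_dep u : dep u <= \max_v dep v by apply: leq_bigmax.
have := ecc_unreached r v; have := le_dep v.
case: (posnP (M r v)) => [->|pos _ _]; first by rewrite er ex /=; lia.
by have [w ew] := ecc_sound pos; rewrite /= ew ex ltnS le_dep.
Qed.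

Lemma ecc_radius_le_order : ecc_radius <= 3 * n.
Proof.
rewrite leq_mul2l /=.
by have [|v ->] := @eq_bigmax _ dep; [apply/card_gt0P; exists s | apply: dep_lt].
Qed.

Lemma runs_ecc w : (2 * w).+1 <= B -> n < 2 ^ w ->
  runs E id B ecc_radius (fun v => ecc_prog (nb v) (3 * n) (v == s)) (fun _ => ecc_radius).
Proof.
move=> wB nw; rewrite -[X in runs _ _ _ X]addn0.
apply: (@runs_bind _ _ _ _ _ _ ecc_radius 0 _ (fun v => (ecc_radius, M ecc_radius v))) => //.
apply: (runs_until id_inj nb_adj _ wB) => [|r v le|r v lt].
- exact: ecc_radius_le_order.
- exact: ecc_stopE.
rewrite -/M /ecc_msg; case e: (M r v) => [|m] //=; split=> //; rewrite andbT.
rewrite -e; have [|u ->] := @ecc_sound r v; first by rewrite e.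
by apply: leq_ltn_trans nw; apply: dep_lt.
Qed.

(** Through the source, two eccentricities suffice; hence the common stopping round is also a valid
    number of hops for broadcasts. *)
Lemma ecc_radius_ge u v : exists2 d, walk (arc id nb) d u v & d <= ecc_radius.
Proof.
exists (dep u + dep v); last first.
  have le_dep w : dep w <= \max_v dep v by apply: leq_bigmax.
  by have := le_dep u; have := le_dep v; rewrite /ecc_radius; lia.
by apply: walkD (dep_walk v); rewrite -walk_rev (@eq_walk _ _ (arc id nb)) ?dep_walk.
Qed.

Lemma ecc_radius_le D : (forall u v, exists2 d, walk (arc id nb) d u v & d <= D) ->
  ecc_radius <= 3 * D.+1.
Proof.
move=> h; rewrite leq_mul2l /= ltnS; apply/bigmax_leqP => v _.
by have [d w le] := h s v; apply: leq_trans (dep_min w) le.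
Qed.

End Ecc.

(** * Replacement paths and detours *)

Lemma sub_walk (T : finType) (R R' : rel T) d u v : subrel R R' -> walk R d u v -> walk R' d u v.
Proof.
move=> sR; elim: d v => [|d IH] v //= /walk_inv[w /IH uw /sR wv].
exact: walkS uw wv.
Qed.

Section ReplacementPaths.

Variables (n : nat) (E : rel 'I_n) (s t : 'I_n) (P : seq 'I_n).
Hypothesis shortest : is_shortest_path E s P t.

Definition pvert (i : nat) : 'I_n := nth s (s :: P) i.

Definition pedge : rel 'I_n :=
  fun u v => [exists i : 'I_(size P), (u == pvert i) && (v == pvert i.+1)].

Definition offpath : rel 'I_n := fun u v => E u v && ~~ pedge u v.

Lemma pvert0 : pvert 0 = s. Proof. by []. Qed.

Lemma pvert_last : pvert (size P) = t.
Proof. by have [/andP[_ /eqP <-] _] := shortest; rewrite (last_nth s). Qed.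

Lemma pvert_edge i : i < size P -> E (pvert i) (pvert i.+1).
Proof. by have [/andP[/(pathP s) h _] _] := shortest; apply: h. Qed.

Lemma shortest_walk d : walk E d s t -> size P <= d.
Proof.
case/walk_pathP=> p [pp pt <-]; have [_] := shortest; apply.
by rewrite /walk_from pp pt eqxx.
Qed.

Lemma walk_pvert (R : rel 'I_n) i j : i <= j <= size P ->
  (forall k, i <= k < j -> R (pvert k) (pvert k.+1)) -> walk R (j - i) (pvert i) (pvert j).
Proof.
case/andP=> /subnKC <-; rewrite addKn; elim: (j - i) => [|d IH]; first by rewrite addn0 /=.
rewrite addnS => le h; apply: (@walkS _ _ _ _ (pvert (i + d))).
  by apply: IH => [|k kd]; [lia | apply: h; lia].
by apply: h; lia.
Qed.

Lemma walk_pvertE i j : i <= j <= size P -> walk E (j - i) (pvert i) (pvert j).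
Proof. by move=> ij; apply: walk_pvert => // k kj; apply: pvert_edge; lia. Qed.

(** Splicing the walk into [P] cannot give less than the length of [P]. The case [d = 0] yields that
    the vertices of [P] are distinct. *)
Lemma pvert_dist a b d : a <= size P -> b <= size P ->
  walk E d (pvert a) (pvert b) -> b <= a + d.
Proof.
move=> ah bh w; have sa := @walk_pvertE 0 a; have bt := @walk_pvertE b (size P).
have := shortest_walk (d := (a - 0) + d + (size P - b)).
rewrite -pvert_last -pvert0 => /(_ _); have -> : walk E (a - 0 + d + (size P - b)) (pvert 0) (pvert (size P)).
  by apply: walkD (walkD _ w) _; [apply: sa | apply: bt]; lia.
by move=> /(_ isT); lia.
Qed.

Lemma pvert_inj i j : i <= size P -> j <= size P -> pvert i = pvert j -> i = j.
Proof.
move=> ih jh e; have h a b : a <= size P -> b <= size P -> pvert a = pvert b -> b <= a.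
  by move=> ah bh ab; rewrite -[a]addn0; apply: pvert_dist => //; rewrite /= ab.
by apply/eqP; rewrite eqn_leq (h i j) ?(h j i).
Qed.

Lemma uniq_pvert : uniq (s :: P).
Proof.
apply/(uniqP s) => i j; rewrite !inE /= !ltnS => ih jh; exact: pvert_inj.
Qed.

Lemma index_pvert i : i <= size P -> index (pvert i) (s :: P) = i.
Proof. by move=> ih; rewrite index_uniq ?uniq_pvert. Qed.

Lemma pedgeP u v :
  reflect (exists2 i, i < size P & u = pvert i /\ v = pvert i.+1) (pedge u v).
Proof.
apply: (iffP existsP) => [[i /andP[/eqP-> /eqP->]]|[i ih [-> ->]]]; first by exists i.
by exists (Ordinal ih); rewrite !eqxx.
Qed.

Section Edge.

Variable i : nat.
Hypothesis ltih : i < size P.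

Let e := (pvert i, pvert i.+1).
Let Ee : rel 'I_n := fun u v => E u v && ((u, v) != e).

Lemma path_avoids u p : path Ee u p = path E u p && avoids e u p.
Proof.
rewrite /avoids; elim: p u => //= v p IH u; rewrite IH /Ee.
by case: (E u v); case: (_ != e); rewrite ?andbF.
Qed.

Lemma replacement_sound a b d : a <= i < b -> b <= size P -> walk offpath d (pvert a) (pvert b) ->
  walk Ee (a + d + (size P - b)) s t.
Proof.
move=> /andP[ai ib] bh w; rewrite -pvert_last -[X in walk _ _ X]pvert0.
have Pe j : j < size P -> j != i -> Ee (pvert j) (pvert j.+1).
  move=> jh ji; rewrite /Ee pvert_edge //; apply: contra ji => /eqP[ji _].
  by apply/eqP/pvert_inj => //; lia.
apply: (walkD (w := pvert b)); last by apply: walk_pvert => [|k kb]; [lia | apply: Pe; lia].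
rewrite -[a in a + d]subn0; apply: (walkD (w := pvert a)).
  by apply: walk_pvert => [|k kb]; [lia | apply: Pe; lia].
apply: sub_walk w => u v /andP[uv np]; rewrite /Ee uv /=; apply: contra np => /eqP[-> ->].
by apply/pedgeP; exists i.
Qed.

(* Invariant along the walk: either it avoids the edges of [P] since a visit to
   some [v_a] with [a <= i], or it has reached in this way some [v_b] with [b > i],
   and from there [P] is at most as long as the rest of the walk. *)
Lemma replacement_complete k : walk Ee k s t ->
  exists a b d, [/\ a <= i < b, b <= size P, walk offpath d (pvert a) (pvert b) &
                    a + d + (size P - b) <= k].
Proof.
move=> wk.
suff H w : walk Ee k s w ->
    (exists a d, [/\ a <= i, walk offpath d (pvert a) w & a + d <= k]) \/
    (exists a b d d', [/\ a <= i < b, b <= size P, walk offpath d (pvert a) (pvert b),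
                       walk E d' (pvert b) w & a + d + d' <= k]).
  case: (H _ wk) => [[a [d [ai w le]]]|[a [b [d [d' [aib bh w w' le]]]]]].
    exists a, (size P), d; rewrite leqnn subnn addn0 pvert_last; split=> //; lia.
  exists a, b, d; split=> //; move: w'; rewrite -pvert_last => /(pvert_dist bh (leqnn _)); lia.
elim: {wk} k w => [|k IH] w; first by move=> /eqP <-; left; exists 0, 0; rewrite /= pvert0.
case/walk_inv=> w0 w0k /andP[E01 ne]; case: (IH _ w0k) => [[a [d [ai w1 le]]]|]; last first.
  move=> [a [b [d [d' [aib bh w1 w2 le]]]]]; right; exists a, b, d, d'.+1; split=> //.
    exact: walkS w2 E01.
  lia.
case: (boolP (pedge w0 w)) => [/pedgeP[j jh [e0 e1]]|np]; last first.
  left; exists a, d.+1; split=> //; last lia.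
  by apply: walkS w1 _; rewrite /offpath E01.
have ji : j != i by apply: contra ne => /eqP ji; rewrite e0 e1 ji.
(* The prefix of [P] up to [v_j] is no longer than the walk. So for [j < i] the walk is exchanged
   for [P] up to [v_(j+1)], a new start with an empty detour; for [j > i] the current detour ends at
   [v_j]. *)
have jk : j <= k.
  have sE : subrel Ee E by move=> u v /andP[].
  move: (sub_walk sE w0k); rewrite e0 -pvert0 => /pvert_dist; apply; lia.
case: (ltngtP j i) ji => // ji _; last first.
  right; exists a, j, d, 1; rewrite -e0; split=> //; try lia.
  by apply: walkS E01; rewrite /=.
by left; exists j.+1, 0; split; rewrite /= ?e1 //; lia.
Qed.

Lemma repl_distP (x : option nat) :
  (forall k, x = Some k -> exists a b d, [/\ a <= i < b, b <= size P,
     walk offpath d (pvert a) (pvert b) & k = a + d + (size P - b)]) ->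
  (forall a b d, a <= i < b -> b <= size P -> walk offpath d (pvert a) (pvert b) ->
     exists2 k, x = Some k & k <= a + d + (size P - b)) ->
  repl_dist E s t e x.
Proof.
move=> xS xC.
have C p : walk_from E s p t -> avoids e s p -> exists2 k, x = Some k & k <= size p.
  move=> /andP[pp /eqP pt] av.
  have /replacement_complete[a [b [d [aib bh w le]]]] : walk Ee (size p) s t.
    by apply/walk_pathP; exists p; rewrite path_avoids pp av.
  by have [k ek le'] := xC _ _ _ aib bh w; exists k => //; apply: leq_trans le.
case: x xS C {xC} => [k|] xS C /=.
  split=> [|p pw av]; last by have [_ [<-]] := C p pw av.
  have [a [b [d [aib bh w ->]]]] := xS _ erefl.
  have /walk_pathP[p [pp pt sp]] := replacement_sound aib bh w.
  exists p; rewrite path_avoids in pp; case/andP: pp => pp ->.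
  by rewrite /walk_from pp pt sp !eqxx.
by move=> p pw; apply/negP => /(C _ pw)[].
Qed.

End Edge.

End ReplacementPaths.

(** * Sampling *)

(* Bernoulli's inequality [(1 - 1/(x+1))^j >= 1 - j/(x+1)] without division. *)
Lemma bernoulli x j : j <= x.+1 -> x.+1 ^ j * (x.+1 - j) <= x ^ j * x.+1.
Proof.
elim: j => [|j IH] jx; first by rewrite !expn0 subn0 !mul1n.
have {}IH := IH (ltnW jx); rewrite !expnS subSS.
have e : x.+1 * (x - j) <= x * (x.+1 - j) by rewrite subSn //; nia.
have -> : x.+1 * x.+1 ^ j * (x - j) = x.+1 ^ j * (x.+1 * (x - j)) by lia.
apply: (@leq_trans (x.+1 ^ j * (x * (x.+1 - j)))); first by rewrite leq_mul2l e orbT.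
have -> : x.+1 ^ j * (x * (x.+1 - j)) = x * (x.+1 ^ j * (x.+1 - j)) by lia.
by rewrite -mulnA leq_mul2l IH orbT.
Qed.

Lemma bernoulli_succ x j : x ^ j * (x + j) <= x.+1 ^ j * x.
Proof.
elim: j => [|j IH]; first by rewrite addn0.
rewrite !expnS; apply: (@leq_trans (x.+1 * (x ^ j * (x + j)))); last first.
  by rewrite -mulnA leq_mul2l IH orbT.
have -> : x * x ^ j * (x + j.+1) = x ^ j * (x * (x + j.+1)) by lia.
have -> : x.+1 * (x ^ j * (x + j)) = x ^ j * (x.+1 * (x + j)) by lia.
by rewrite leq_mul2l; apply/orP; right; lia.
Qed.

(** This is (1 + 1/x)^x <= 4: Bernoulli's inequality with exponent x/2 bounds the square root by 2.
    In the application x is a power of two. *)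
Lemma expn_succ_le x : 0 < x -> (x = 1) \/ (exists y, x = 2 * y) -> x.+1 ^ x <= 4 * x ^ x.
Proof.
move=> x0 [->|[y ey]]; first by [].
have H : x.+1 ^ y <= 2 * x ^ y.
  have := @bernoulli x y; have -> : x.+1 - y = y.+1 by lia.
  move=> /(_ ltac:(lia)) le; rewrite -(@leq_pmul2r y.+1) //; apply: leq_trans le _.
  have -> : 2 * x ^ y * y.+1 = x ^ y * (2 * y.+1) by lia.
  by rewrite leq_mul2l; apply/orP; right; lia.
have -> : x.+1 ^ x = x.+1 ^ y * x.+1 ^ y by rewrite -expnD; congr (_ ^ _); lia.
have -> : x ^ x = x ^ y * x ^ y by rewrite -expnD; congr (_ ^ _); lia.
by have := leq_mul H H; lia.
Qed.

(** This is (1 - 1/x)^x <= 1/2, from (1 + 1/(x-1))^x >= 1 + x/(x-1) >= 2. *)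
Lemma expn_pred_le x : 0 < x -> 2 * x.-1 ^ x <= x ^ x.
Proof.
case: x => // -[|x] _ //; rewrite -(leq_pmul2r (ltn0Sn x)) [x.+2.-1]/=.
apply: leq_trans (bernoulli_succ x.+1 x.+2).
by rewrite mulnAC mulnC leq_mul2l; apply/orP; right; lia.
Qed.

Section Sampling.

Variables (n : nat) (T : finType) (z : pred T).
Hypothesis z1 : #|z| = 1.

Let x := #|T|.

(** Independent coins of probability 1/x: each vertex draws uniformly from [T], and exactly one
    value is a success. Probabilities are counted as numbers of functions [f] out of [x ^ n]. *)
Let sampled (f : {ffun 'I_n -> T}) : {set 'I_n} := [set v | z (f v)].

Lemma x_gt0 : 0 < x.
Proof. by rewrite -z1; apply: max_card. Qed.

Lemma card_miss (A : {set 'I_n}) :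
  #|[set f | [disjoint sampled f & A]]| = x.-1 ^ #|A| * x ^ (n - #|A|).
Proof.
pose F v := if v \in A then [pred w | ~~ z w] else predT.
have -> : #|[set f | [disjoint sampled f & A]]| = #|family F|.
  rewrite cardsE; apply: eq_card => f; rewrite !inE.
  apply/idP/familyP => [dis v|fF].
    rewrite /F; case: ifP => // vA; rewrite inE; apply/negP => zv.
    by have /pred0P/(_ v) := dis; rewrite /= vA inE zv.
  apply/pred0P => v /=; rewrite inE; apply/negP => /andP[zv vA].
  by have := fF v; rewrite /F vA inE zv.
rewrite card_family; have -> : foldr muln 1 [seq #|F v| | v : 'I_n] = \prod_v #|F v|.
  by rewrite foldrE big_map big_enum.
rewrite (bigID (mem A)) /= (eq_bigr (fun _ => x.-1)) => [|v vA]; last first.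
  by have := cardC z; rewrite z1 -/x => <-; rewrite /F vA; apply: eq_card.
rewrite [X in _ * X](eq_bigr (fun _ => x)) => [|v vA]; last by rewrite /F (negbTE vA).
rewrite !prod_nat_const; congr (_ * x ^ _).
have := cardC (mem A); rewrite [X in _ = X -> _]card_ord => e.
have An : #|A| <= n by rewrite -[X in _ <= X]e leq_addr.
by apply: (@addnI #|A|); rewrite subnKC.
Qed.

(** Each block of x elements of [A] contributes a factor (1 - 1/x)^x <= 1/2. *)
Lemma card_miss_le (A : {set 'I_n}) k : x * k <= #|A| ->
  #|[set f | [disjoint sampled f & A]]| * 2 ^ k <= x ^ n.
Proof.
move=> le; rewrite card_miss mulnAC.
have An : #|A| <= n by have := max_card (mem A); rewrite card_ord.
rewrite -[X in _ <= x ^ X](subnKC An) expnD leq_mul2r; apply/orP; right.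
rewrite -(subnKC le) !expnD -mulnA [_ * 2 ^ k]mulnC mulnA leq_mul //; last first.
  by case: (#|A| - x * k) => // a; rewrite leq_exp2r ?leq_pred.
rewrite !expnM -expnMn; case: k {le} => // k; rewrite leq_exp2r //.
by rewrite mulnC; apply: expn_pred_le x_gt0.
Qed.

(* The moment generating function at [ln 2], for the Chernoff bound below. *)
Lemma sum_expn_sampled : \sum_f 2 ^ #|sampled f| = x.+1 ^ n.
Proof.
have e : \prod_(v < n) \sum_(w : T) (if z w then 2 else 1) = x.+1 ^ n.
  rewrite prod_nat_const card_ord; congr (_ ^ n).
  rewrite (bigID z) /= (eq_bigr (fun _ => 2)) => [|w ->] //.
  rewrite [X in _ + X](eq_bigr (fun _ => 1)) => [|w /negbTE->] //.
  rewrite !sum_nat_const z1 mul1n muln1.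
  by have := cardC z; rewrite z1 /x => <-.
rewrite -e bigA_distr_bigA /=; apply: eq_bigr => f _.
by rewrite -big_mkcond prod_nat_const cardsE.
Qed.

(** Markov's inequality for [2 ^ #|sampled f|], whose mean is (1 + 1/x)^n <= 4^q. *)
Lemma card_sampled_le q K : x.+1 ^ x <= 4 * x ^ x -> n <= x * q ->
  #|[set f | K <= #|sampled f|]| * 2 ^ K <= 4 ^ q * x ^ n.
Proof.
move=> x4 nq; apply: (@leq_trans (x.+1 ^ n)).
  rewrite -sum_expn_sampled -sum_nat_const big_mkcond /=.
  apply: leq_sum => f _; rewrite inE; case: ifP => // le.
  by rewrite leq_exp2l.
(* The padding rounds the exponent [n] up to [x * q], so that the hypothesis on [x] applies [q]
   times. *)
have x0 := x_gt0; rewrite -(@leq_pmul2r (x ^ (x * q - n))) ?expn_gt0 ?x0 //.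
rewrite -mulnA -expnD subnKC //; apply: (@leq_trans (x.+1 ^ (x * q))).
  rewrite -{2}(subnKC nq) expnD leq_mul2l; apply/orP; right.
  by case: (_ - n) => // a; rewrite leq_exp2r.
rewrite !expnM -expnMn; case: q {nq} => // q.
by rewrite leq_exp2r.
Qed.

(** Union bound: too many samples, and some large set missed, are each given probability 1/(2n). *)
Lemma sampling_good (I : finType) (fam : I -> {set 'I_n}) q k K :
  x.+1 ^ x <= 4 * x ^ x -> n <= x * q -> #|I| * (2 * n) <= 2 ^ k -> 4 ^ q * (2 * n) <= 2 ^ K ->
  exists Good : {set {ffun 'I_n -> T}}, #|~: Good| * n <= x ^ n /\
    forall f, f \in Good -> #|sampled f| < K /\
      forall i, x * k <= #|fam i| -> exists2 v, v \in fam i & z (f v).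
Proof.
move=> x4 nq Ik qK.
pose big := [pred i | x * k <= #|fam i|].
pose bad1 := [set f | K <= #|sampled f|].
pose bad2 := \bigcup_(i in big) [set f | [disjoint sampled f & fam i]].
exists (~: (bad1 :|: bad2)); rewrite setCK; split; last first.
  move=> f; rewrite !inE negb_or -ltnNge => /andP[-> nb2]; split=> // i ib.
  have : ~~ [disjoint sampled f & fam i].
    by apply: contra nb2 => dis; apply/bigcupP; exists i; rewrite ?inE.
  by rewrite -setI_eq0 => /set0Pn[v]; rewrite !inE => /andP[zv vA]; exists v.
have le1 : #|bad1| * (2 * n) <= x ^ n.
  rewrite -(@leq_pmul2l (4 ^ q)) ?expn_gt0 //; apply: leq_trans (card_sampled_le K x4 nq).
  by rewrite mulnCA leq_mul2l qK orbT.
have le2 : #|bad2| * (2 * n) <= x ^ n.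
  have b2 : #|bad2| * 2 ^ k <= #|I| * x ^ n.
    apply: (@leq_trans (\sum_(i in big) #|[set f | [disjoint sampled f & fam i]]| * 2 ^ k)).
      rewrite -big_distrl leq_mul2r /=; apply/orP; right.
      rewrite /bad2; elim/big_ind2: _ => [|a b c d ac bd|//]; first by rewrite cards0.
      by apply: leq_trans (leq_add ac bd); rewrite cardsU leq_subr.
    apply: (@leq_trans (\sum_(i in big) x ^ n)); first by apply: leq_sum => i; apply: card_miss_le.
    by rewrite sum_nat_const leq_mul2r max_card orbT.
  have [I0|I0] := posnP #|I|.
    by move: b2; rewrite I0 leqn0 muln_eq0 expn_eq0 /= orbF => /eqP ->.
  rewrite -(@leq_pmul2l #|I|) //; apply: leq_trans b2.
  by rewrite mulnCA leq_mul2l Ik orbT.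
have le : #|bad1 :|: bad2| <= #|bad1| + #|bad2| by rewrite cardsU leq_subr.
rewrite -(@leq_pmul2l 2) // mulnCA; apply: (@leq_trans ((#|bad1| + #|bad2|) * (2 * n))).
  by rewrite leq_mul2r le orbT.
by rewrite mulnDl [leqRHS]mul2n -addnn leq_add.
Qed.

End Sampling.

(** * Distances through landmarks, and scans *)

(** Distances below are computed by such searches; a result equal to the bound stands for
    infinity. *)
Lemma find_iota (p : pred nat) N :
  (find p (iota 0 N) < N -> p (find p (iota 0 N))) /\
  (forall d, d < N -> p d -> find p (iota 0 N) <= d).
Proof.
split=> [lt|d dN pd].
  have hp : has p (iota 0 N) by rewrite has_find size_iota.
  by have := nth_find 0 hp; rewrite nth_iota.
rewrite leqNgt; apply/negP => lt.
have := before_find 0 lt; rewrite nth_iota ?pd //.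
Qed.

(* [es] lists triples (landmark, landmark, length); [est] lists the keys of the
   landmarks close to the vertex under consideration.  [lreach f d l] says that a
   chain of at most [f] triples followed by one key leads from [l] to that vertex
   in [d] steps. *)
Section LocalDistance.

Variables (M : nat) (es : seq (nat * nat * nat)) (est : seq nat).

Fixpoint lreach (f d l : nat) : bool :=
  (d * M + l \in est) ||
  (if f is f'.+1 then
     has (fun e => [&& e.1.1 == l, e.2 <= d & lreach f' (d - e.2) e.1.2]) es
   else false).

Definition ldist (N l : nat) : nat := find (fun d => lreach N d l) (iota 0 N).

End LocalDistance.

Definition wmin (T : finType) (R : rel T) d u v := walk R d u v /\ forall d', walk R d' u v -> d <= d'.

Lemma wmin_exists (T : finType) (R : rel T) d u v : walk R d u v ->
  exists2 d', d' <= d & wmin R d' u v.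
Proof.
move=> w; have ex : exists d, walk R d u v by exists d.
by case: (ex_minnP ex) => m wm mm; exists m; [apply: mm | split].
Qed.

Lemma wmin_lt (T : finType) (R : rel T) d u v : wmin R d u v -> d < #|T|.
Proof. by case=> w m; have [d' [_ lt] /m le] := walk_shorten w; apply: leq_ltn_trans lt. Qed.

Lemma wmin_splitl (T : finType) (R : rel T) d1 d2 u w v :
  wmin R (d1 + d2) u v -> walk R d1 u w -> walk R d2 w v -> wmin R d1 u w /\ wmin R d2 w v.
Proof.
case=> _ mn w1 w2; split; split=> // d'.
  by move=> w'; have := mn _ (walkD w' w2); rewrite leq_add2r.
by move=> w'; have := mn _ (walkD w1 w'); rewrite leq_add2l.
Qed.

(** The landmark is at most [m] steps from the start, so that the link to it is detected, and at
    least one, so that chains of links make progress. *)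
Definition hits (T : finType) (R : rel T) (Z : {set T}) (m : nat) : Prop :=
  forall u v d, wmin R d u v -> m <= d ->
    exists w d1 d2, [/\ w \in Z, 0 < d1 <= m, d1 + d2 = d, walk R d1 u w & walk R d2 w v].

Section LandmarkDistance.

Variables (n : nat) (id : 'I_n -> nat) (R : rel 'I_n) (Z : {set 'I_n}) (M m : nat).
Variables (es : seq (nat * nat * nat)) (est : seq nat) (v : 'I_n).
Hypothesis id_inj : injective id.
Hypothesis id_lt : forall u, id u < M.
Hypothesis es_sound : forall l l' o, (l, l', o) \in es ->
  exists u w, [/\ l = id u, l' = id w & walk R o u w].
Hypothesis es_complete : forall u w d, u \in Z -> w \in Z -> wmin R d u w -> d <= m ->
  (id u, id w, d) \in es.
Hypothesis est_sound : forall k, k \in est -> exists2 u, k %% M = id u & walk R (k %/ M) u v.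
Hypothesis est_complete : forall u d, u \in Z -> walk R d u v -> d <= m ->
  exists2 d', d' <= d & d' * M + id u \in est.
Hypothesis hitsP : hits R Z m.

Lemma lreach_sound f d u : lreach M es est f d (id u) -> walk R d u v.
Proof.
have base d' u' : d' * M + id u' \in est -> walk R d' u' v.
  move=> /est_sound[w]; rewrite modnMDl modn_small // => /id_inj <-.
  by rewrite divnMDl ?divn_small ?addn0 //; apply: leq_ltn_trans (id_lt u').
elim: f d u => [|f IH] d u /= /orP[] //; [exact: base | exact: base |].
case/hasP=> -[[l l'] o] /es_sound[u' [w [-> -> w1]]] /= /and3P[/eqP/id_inj <- od /IH w2].
by rewrite -(subnKC od); apply: walkD w1 w2.
Qed.

(** Cut a long walk at the landmark given by [hits]: both pieces are minimal, so the first is a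
    known triple and induction treats the second. Links have positive length, so fuel [d] is
    enough. *)
Lemma lreach_complete f d u : u \in Z -> wmin R d u v -> d <= f -> lreach M es est f d (id u).
Proof.
elim/ltn_ind: d f u => d IH f u uZ wm df.
case: (leqP m d) => [md|dm].
  have [w [d1 [d2 [wZ /andP[d0 d1m] ed w1 w2]]]] := hitsP wm md.
  rewrite -ed in wm; have [m1 m2] := wmin_splitl wm w1 w2.
  case: f df => [|f] df; first lia.
  rewrite /=; apply/orP; right; apply/hasP; exists (id u, id w, d1); first exact: es_complete.
  have -> : d - d1 = d2 by lia.
  by rewrite /= eqxx (IH d2) //; lia.
have [d' le k] := est_complete uZ (proj1 wm) (ltnW dm).
have e : d' = d.
  apply/eqP; rewrite eqn_leq le; apply: (proj2 wm).
  by apply: (@lreach_sound 0); rewrite /= k.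
by case: f {df} => [|f] /=; rewrite -e k.
Qed.

Lemma ldist_sound u : ldist M es est n (id u) < n -> walk R (ldist M es est n (id u)) u v.
Proof. by move=> lt; have [h _] := find_iota (fun d => lreach M es est n d (id u)) n; apply/lreach_sound/h. Qed.

Lemma ldist_complete u d : u \in Z -> walk R d u v -> ldist M es est n (id u) <= d.
Proof.
move=> uZ /wmin_exists[d' le wm]; apply: leq_trans le.
have lt := wmin_lt wm; rewrite card_ord in lt.
have [_] := find_iota (fun d => lreach M es est n d (id u)) n; apply=> //.
by apply: lreach_complete => //; apply: ltnW.
Qed.

End LandmarkDistance.

(* In a scan, the vertex at offset [o v] handles item [j] in round [o v + j]. *)
Definition scan_entry INF J (o : nat) (val : nat -> nat) (r : nat) : nat :=
  if (o <= r) && (r - o < J) then val (r - o) else INF.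

Section Scan.

Variables (n : nat) (id : 'I_n -> nat) (nb : 'I_n -> seq nat).
Variables (INF J : nat) (o : 'I_n -> nat) (val : 'I_n -> nat -> nat).
Hypothesis o_arc : forall u v, arc id nb u v -> o v = (o u).+1.

Lemma o_walk d u v : walk (arc id nb) d u v -> o v = o u + d.
Proof.
elim: d v => [|d IH] v; first by move=> /eqP->; rewrite addn0.
by case/walk_inv=> w /IH ow /o_arc ->; rewrite ow addnS.
Qed.

Variables (T : nat) (z : 'I_n -> seq nat).
Hypothesis zP : pipe_spec id nb INF (fun v => scan_entry INF J (o v) (val v)) T z.

(** Offsets grow by one per arc, so the item [j] handled by [u] in round [o u + j] meets [v] in
    round [o v + j]: values of different items never mix. *)
Lemma scan_sound v j : o v + j <= T -> nth INF (z v) (o v + j) < INF ->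
  exists u d, [/\ 0 < d, walk (arc id nb) d u v & nth INF (z v) (o v + j) = val u j].
Proof.
move=> le lt; have [zS _] := zP; have [u [d [/andP[d0 dr] w e]]] := zS _ _ le lt.
exists u, d; split=> //; move: lt; rewrite e (o_walk w) /scan_entry.
have -> : o u + d + j - d = o u + j by lia.
by rewrite leq_addr addKn; case: ifP => //; rewrite ltnn.
Qed.

Lemma scan_complete v j u d : o v + j <= T -> j < J -> 0 < d -> walk (arc id nb) d u v ->
  nth INF (z v) (o v + j) <= val u j.
Proof.
move=> le jJ d0 w; have [_ zC] := zP; have ow := o_walk w.
have := zC _ _ _ d le _ w; rewrite /scan_entry.
have -> : o v + j - d = o u + j by lia.
by rewrite leq_addr addKn jJ; apply; lia.
Qed.

End Scan.

Section Quad.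

Variable M : nat.

(** Digits in base [M]: a tag and three numbers become one broadcast label. *)
Definition quad (t a b o : nat) : nat := t + M * (a + M * (b + M * o)).
Definition quad1 (l : nat) := l %% M.
Definition quad2 (l : nat) := l %/ M %% M.
Definition quad3 (l : nat) := l %/ M %/ M %% M.
Definition quad4 (l : nat) := l %/ M %/ M %/ M.

Lemma quadE t a b o : t < M -> a < M -> b < M ->
  [/\ quad1 (quad t a b o) = t, quad2 (quad t a b o) = a,
      quad3 (quad t a b o) = b & quad4 (quad t a b o) = o].
Proof.
move=> tM aM bM; have M0 : 0 < M by apply: leq_ltn_trans tM.
have S x y : x < M -> (x + M * y) %/ M = y.
  by move=> xM; rewrite addnC mulnC divnMDl // divn_small // addn0.
have S' x y : x < M -> (x + M * y) %% M = x.
  by move=> xM; rewrite addnC mulnC modnMDl modn_small.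
by rewrite /quad /quad1 /quad2 /quad3 /quad4 !S ?S'.
Qed.

Lemma quad_lt t a b o : t < M -> a < M -> b < M -> o < M -> quad t a b o < M ^ 4.
Proof.
have H x y k : x < M -> y < M ^ k -> x + M * y < M ^ k.+1.
  move=> xM yk; rewrite expnS; apply: (@leq_trans (M * y.+1)); last by rewrite leq_mul2l yk orbT.
  by rewrite mulnS ltn_add2r.
by move=> tM aM bM oM; rewrite /quad; apply: (H t _ 3) => //; apply: (H a _ 2) => //; apply: (H b _ 1); rewrite ?expn1.
Qed.

End Quad.

(** * The local inputs *)

Definition seq_of_opt (o : option nat) : seq nat := if o is Some x then [:: x] else [::].

(** Arcs run from the neighbours listened to, so the tags select G, H (G without the edges of [P])
    and the reverse of H; with the last, distances to a landmark become distances from it. *)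
Definition nbr_in (tag : nat) (I : local_input) : seq nat :=
  match tag with
  | 0 => li_in_nbrs I
  | 1 => [seq x <- li_in_nbrs I | Some x != li_P_prev I]
  | _ => [seq x <- li_out_nbrs I | Some x != li_P_next I]
  end.

Definition nbr_all (I : local_input) : seq nat := li_out_nbrs I ++ li_in_nbrs I.

Definition on_path (I : local_input) : bool := isSome (li_P_prev I) || isSome (li_P_next I).

Section LocalInputs.

Variables (n : nat) (E : rel 'I_n) (id : 'I_n -> nat) (s t : 'I_n) (P : seq 'I_n).
Hypothesis irrE : irreflexive E.
Hypothesis id_inj : injective id.
Hypothesis shortest : is_shortest_path E s P t.

Local Notation inp := (local_inputs E id s t P).
Local Notation pvert := (pvert s P).
Local Notation pedge := (pedge s P).
Local Notation offpath := (offpath E s P).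

Lemma E_uadj u v : E u v -> uadj E u v && uadj E v u.
Proof.
move=> uv; rewrite /uadj uv orbT /= !andbT [v == u]eq_sym andbb.
by apply: contraTneq uv => ->; rewrite irrE.
Qed.

Lemma uadj_sym : symmetric (uadj E).
Proof. by move=> u v; rewrite /uadj eq_sym orbC. Qed.

Lemma mem_out v x : reflect (exists2 u, E v u & id u = x) (x \in li_out_nbrs (inp v)).
Proof.
rewrite /= mem_sort; apply: (iffP mapP) => [[u]|[u vu <-]].
  by rewrite mem_filter => /andP[vu _] ->; exists u.
by exists u => //; rewrite mem_filter mem_enum andbT.
Qed.

Lemma mem_in v x : reflect (exists2 u, E u v & id u = x) (x \in li_in_nbrs (inp v)).
Proof.
rewrite /= mem_sort; apply: (iffP mapP) => [[u]|[u vu <-]].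
  by rewrite mem_filter => /andP[vu _] ->; exists u.
by exists u => //; rewrite mem_filter mem_enum andbT.
Qed.

Lemma index_path v : index v (s :: P) <= size P -> pvert (index v (s :: P)) = v.
Proof. by move=> le; apply: nth_index; rewrite -index_mem. Qed.

Lemma P_prevE v : li_P_prev (inp v) =
  let i := index v (s :: P) in
  if (0 < i) && (i <= size P) then Some (id (pvert i.-1)) else None.
Proof. by []. Qed.

Lemma P_nextE v : li_P_next (inp v) =
  let i := index v (s :: P) in if i < size P then Some (id (pvert i.+1)) else None.
Proof. by []. Qed.

Lemma P_prevP v u : (li_P_prev (inp v) == Some (id u)) = pedge u v.
Proof.
rewrite P_prevE; apply/idP/(pedgeP s P) => [|[i ih [-> ->]]].
  have := @index_path v; move: (index v _) => i /= vi.
  case: ifP => // /andP[i0 ih] /eqP[/id_inj <-].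
  by exists i.-1; [lia | rewrite prednK // vi].
by rewrite (index_pvert shortest ih) /= ih.
Qed.

Lemma P_nextP v u : (li_P_next (inp v) == Some (id u)) = pedge v u.
Proof.
rewrite P_nextE; apply/idP/(pedgeP s P) => [|[i ih [-> ->]]].
  have := @index_path v; move: (index v _) => i /= vi.
  case: ifP => // ih /eqP[/id_inj <-].
  by exists i; rewrite // vi // ltnW.
by rewrite (index_pvert shortest (ltnW ih)) /= ih.
Qed.

Lemma P_prev_some v x : li_P_prev (inp v) = Some x -> exists u, id u = x.
Proof. by rewrite P_prevE /=; case: ifP => // _ [<-]; eexists. Qed.

Lemma P_next_some v x : li_P_next (inp v) = Some x -> exists u, id u = x.
Proof. by rewrite P_nextE /=; case: ifP => // _ [<-]; eexists. Qed.

Lemma on_pathP v : 0 < size P -> reflect (exists2 i, i <= size P & v = pvert i) (on_path (inp v)).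
Proof.
move=> h0; rewrite /on_path.
apply: (iffP orP) => [[|]|[i ih ->]].
- case e: (li_P_prev _) => [x|] // _; have [u eu] := P_prev_some e.
  move/eqP: e; rewrite -eu P_prevP => /(pedgeP s P)[i ih [_ ->]].
  by exists i.+1.
- case e: (li_P_next _) => [x|] // _; have [u eu] := P_next_some e.
  move/eqP: e; rewrite -eu P_nextP => /(pedgeP s P)[i ih [-> _]].
  by exists i => //; apply: ltnW.
- case: (ltnP i (size P)) => [lt|ge].
    right; have : pedge (pvert i) (pvert i.+1) by apply/pedgeP; exists i.
    by rewrite -P_nextP => /eqP->.
  left; have : pedge (pvert i.-1) (pvert i).
    by apply/pedgeP; exists i.-1; rewrite ?prednK //; lia.
  by rewrite -P_prevP => /eqP->.
Qed.

Lemma pedge_E u v : pedge u v -> E u v.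
Proof. by case/pedgeP=> i ih [-> ->]; apply: (pvert_edge shortest). Qed.

Lemma arc_nbr_in0 : arc id (fun v => nbr_in 0 (inp v)) =2 E.
Proof.
move=> u v; apply/mem_in/idP => [[w wv /id_inj <- //]|uv]; by exists u.
Qed.

Lemma arc_nbr_in1 : arc id (fun v => nbr_in 1 (inp v)) =2 offpath.
Proof.
move=> u v; rewrite /arc /nbr_in mem_filter eq_sym P_prevP andbC; congr (_ && _).
by apply/mem_in/idP => [[w wv /id_inj <- //]|uv]; exists u.
Qed.

Lemma arc_nbr_in2 : arc id (fun v => nbr_in 2 (inp v)) =2 (fun u v => offpath v u).
Proof.
move=> u v; rewrite /arc /nbr_in mem_filter eq_sym P_nextP andbC; congr (_ && _).
by apply/mem_out/idP => [[w wv /id_inj <- //]|uv]; exists u.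
Qed.

Lemma arc_nbr_all : arc id (fun v => nbr_all (inp v)) =2 uadj E.
Proof.
move=> u v; rewrite /arc /nbr_all mem_cat; apply/idP/idP => [/orP[/mem_out|/mem_in]|].
- by case=> w /E_uadj/andP[_ +] /id_inj <-.
- by case=> w /E_uadj/andP[+ _] /id_inj <-.
case/andP=> _ /orP[] uv; apply/orP; [right; apply/mem_in | left; apply/mem_out]; by exists u.
Qed.

Lemma arc_prev : arc id (fun v => seq_of_opt (li_P_prev (inp v))) =2 pedge.
Proof.
move=> u v; rewrite -P_prevP /arc; case: (li_P_prev _) => [x|] //=.
by rewrite inE eq_sym.
Qed.

Lemma arc_next : arc id (fun v => seq_of_opt (li_P_next (inp v))) =2 (fun u v => pedge v u).
Proof.
move=> u v; rewrite -P_nextP /arc; case: (li_P_next _) => [x|] //=.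
by rewrite inE eq_sym.
Qed.

Lemma nbr_all_adj v x : x \in nbr_all (inp v) -> exists2 u, uadj E v u & id u = x.
Proof.
by rewrite mem_cat => /orP[/mem_out|/mem_in] [u /E_uadj/andP[uv vu] <-]; exists u.
Qed.

Lemma nbr_in_adj tag v x : x \in nbr_in tag (inp v) -> exists2 u, uadj E v u & id u = x.
Proof.
move=> xv; apply: nbr_all_adj; rewrite mem_cat; case: tag xv => [->|[|tag]]; rewrite ?orbT //.
  by rewrite mem_filter => /andP[_ ->]; rewrite orbT.
by rewrite mem_filter => /andP[_ ->].
Qed.

Lemma prev_adj v x : x \in seq_of_opt (li_P_prev (inp v)) -> exists2 u, uadj E v u & id u = x.
Proof.
case e: (li_P_prev _) => [y|] //; rewrite inE => /eqP ->; have [u eu] := P_prev_some e.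
exists u => //; move/eqP: e; rewrite -eu P_prevP => /pedge_E/E_uadj/andP[] //.
Qed.

Lemma next_adj v x : x \in seq_of_opt (li_P_next (inp v)) -> exists2 u, uadj E v u & id u = x.
Proof.
case e: (li_P_next _) => [y|] //; rewrite inE => /eqP ->; have [u eu] := P_next_some e.
exists u => //; move/eqP: e; rewrite -eu P_nextP => /pedge_E/E_uadj/andP[] //.
Qed.

Lemma uadj_walk D : udiam_le E D -> forall u v, exists2 d, walk (uadj E) d u v & d <= D.
Proof.
move=> h u v; have [p /and3P[pp /eqP pv sp]] := h u v.
by exists (size p) => //; apply/walk_pathP; exists p.
Qed.

End LocalInputs.

(** * Learning indices and landmark distances *)

Definition lg n := (trunc_log 2 n).+1.
(** The sampling probability [1 / 2 ^ srate n], about n^(-2/3), is a power of two so that [srate n]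
    fair bits realize it exactly. *)
Definition srate n := trunc_log 2 (cbrt_up (n ^ 2)).
(** A set of this size is missed with probability at most [2 ^ -(3 * lg n + 3)], below 1/(8 n^3);
    this pays for 3 n^2 sets and a factor 2n. *)
Definition hops n := 2 ^ srate n * (3 * lg n + 3).
(** In the Chernoff bound the first term cancels [4 ^ q] and the rest pays for 2n. The number of
    samples is strictly smaller, which leaves room for [s]. *)
Definition cap n := 2 * (n %/ 2 ^ srate n).+1 + lg n + 1.
(** Exceeds all identifiers; the three extra factors make room for [inf n] and the tags. *)
Definition base ie n := 2 ^ ((ie + 3) * lg n).

Definition landmark (I : local_input) (bits : seq bool) : bool := li_is_s I || all negb bits.

Definition est_of (k0 k1 k2 : seq nat) (tag : nat) : seq nat :=
  match tag with 0 => k0 | 1 => k1 | _ => k2 end.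

Definition omin n M (K : seq nat) l := find (fun o => o * M + l \in K) (iota 0 n).

(** Tags 0, 1, 2 carry the detected distance from landmark [l] to this landmark in the three
    relations of [nbr_in]; tag 3 announces the identifier of [s]. *)
Definition dist_tokens n M (I : local_input) (k : nat -> seq nat) : seq nat :=
  [seq quad M tag l (li_id I) (omin n M (k tag) l)
     | tag <- iota 0 3, l <- [seq l <- [seq x %% M | x <- k tag] | omin n M (k tag) l < n]]
  ++ (if li_is_s I then [:: quad M 3 (li_id I) 0 0] else [::]).

Definition triples M (toks : seq nat) (tag : nat) : seq (nat * nat * nat) :=
  [seq (quad2 M x, quad3 M x, quad4 M x) | x <- toks & quad1 M x == tag].

(** Each landmark detects itself at distance 0 and so issues a token of tag 1 about itself.
    Filtering [iota] gives all vertices the same list in the same order, so position [j] means the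
    same landmark everywhere. *)
Definition landmark_ids M (toks : seq nat) : seq nat :=
  [seq l <- iota 0 M | has (fun x => (quad1 M x == 1) && (quad2 M x == l)) toks].

Definition source_id M (toks : seq nat) : nat :=
  head 0 [seq quad2 M x | x <- toks & quad1 M x == 3].

Record knowledge := Knowledge {
  kn_radius : nat;
  kn_index : nat;
  kn_landmarks : seq nat;
  kn_from : nat -> nat;
  kn_to : nat -> nat
}.

(** Each duration is a number of hops plus a bound on the number of labels: at most [cap n]
    landmarks, then at most [3 * cap n * cap n + 1] tokens. *)
Definition learn ie (I : local_input) (bits : seq bool) : prog knowledge :=
  let n := li_n I in let M := base ie n in let isl := landmark I bits in
  let lab := if isl then [:: li_id I] else [::] in
  let T := hops n + cap n in
  bind (ecc_prog (nbr_all I) (3 * n) (li_is_s I)) (fun R =>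
  bind (sd (nbr_in 0 I) M T lab) (fun k0 =>
  bind (sd (nbr_in 1 I) M T lab) (fun k1 =>
  bind (sd (nbr_in 2 I) M T lab) (fun k2 =>
  let k := est_of k0 k1 k2 in
  bind (sd (nbr_all I) (M ^ 4) (R + (3 * cap n * cap n + 1))
          (if isl then dist_tokens n M I k else [::])) (fun kt =>
  let toks := [seq x %% M ^ 4 | x <- kt] in
  let dist tag := ldist M (triples M toks tag) (k tag) n in
  Ret (Knowledge R (dist 0 (source_id M toks)) (landmark_ids M toks) (dist 1) (dist 2))))))).

Section Learn.

Variables (ie n : nat) (E : rel 'I_n) (id : 'I_n -> nat) (s t : 'I_n) (P : seq 'I_n) (D B : nat).
Hypothesis irrE : irreflexive E.
Hypothesis id_inj : injective id.
Hypothesis shortest : is_shortest_path E s P t.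
Hypothesis diam : udiam_le E D.

Local Notation inp := (local_inputs E id s t P).
Local Notation pvert := (pvert s P).
Local Notation offpath := (offpath E s P).
Local Notation M := (base ie n).

Variable rnd : 'I_n -> seq bool.

Definition Z : {set 'I_n} := [set v | landmark (inp v) (rnd v)].

Definition tag_rel (tag : nat) : rel 'I_n :=
  match tag with 0 => E | 1 => offpath | _ => fun u v => offpath v u end.

Hypothesis id_lt : forall u, id u < M.
Hypothesis n_lt : n < M.
Hypothesis M_gt : 3 < M.
Hypothesis Zcap : #|Z| <= cap n.
Hypothesis Zhits : forall tag, tag < 3 -> hits (tag_rel tag) Z (hops n).

Variable w : nat.
Hypothesis wB : (2 * w).+1 <= B.
Hypothesis MT : M ^ 4 * (3 * n + (hops n + cap n) + (3 * cap n * cap n + 1)) <= 2 ^ w.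

Record learn_spec (kn : 'I_n -> knowledge) (R : nat) : Prop := LearnSpec {
  ls_radius : forall v, kn_radius (kn v) = R;
  ls_reach : forall u v, exists2 d, walk (uadj E) d u v & d <= R;
  ls_index : forall i, i <= size P -> kn_index (kn (pvert i)) = i;
  ls_landmarks : exists lms, [/\ forall v, kn_landmarks (kn v) = lms, size lms <= cap n &
      forall l, l \in lms <-> exists2 u, u \in Z & l = id u];
  ls_from_sound : forall v u, u \in Z -> kn_from (kn v) (id u) < n ->
      walk offpath (kn_from (kn v) (id u)) u v;
  ls_from_complete : forall v u d, u \in Z -> walk offpath d u v -> kn_from (kn v) (id u) <= d;
  ls_to_sound : forall v u, u \in Z -> kn_to (kn v) (id u) < n ->
      walk offpath (kn_to (kn v) (id u)) v u;
  ls_to_complete : forall v u d, u \in Z -> walk offpath d v u -> kn_to (kn v) (id u) <= d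
}.

Lemma s_in_Z : s \in Z.
Proof. by rewrite inE /landmark /= eqxx. Qed.

Definition est_spec (K : 'I_n -> seq nat) tag : Prop :=
  (forall v k, k \in K v -> exists u, [/\ u \in Z, k %% M = id u & walk (tag_rel tag) (k %/ M) u v]) /\
  (forall v u d, u \in Z -> walk (tag_rel tag) d u v -> d <= hops n ->
     exists2 d', d' <= d & d' * M + id u \in K v).

Lemma arc_tag tag : tag < 3 -> arc id (fun v => nbr_in tag (inp v)) =2 tag_rel tag.
Proof.
case: tag => [|[|[|//]]] _; [exact: arc_nbr_in0 | exact: arc_nbr_in1 | exact: arc_nbr_in2].
Qed.

Lemma runs_est tag : tag < 3 -> exists2 K,
  runs E id B (hops n + cap n) (fun v => sd (nbr_in tag (inp v)) M (hops n + cap n)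
    (if landmark (inp v) (rnd v) then [:: li_id (inp v)] else [::])) K & est_spec K tag.
Proof.
move=> tag3; pose lab v := if landmark (inp v) (rnd v) then [:: li_id (inp v)] else [::].
have labE u l : l \in lab u = (u \in Z) && (l == id u).
  by rewrite /lab [u \in Z]inE; case: ifP => //= _; rewrite inE.
have [||||K runK [KS KC]] := @runs_sd n E id B (fun v => nbr_in tag (inp v)) id_inj
   (nbr_in_adj irrE (tag := tag)) M lab [seq id u | u in Z] (hops n) (hops n + cap n) w.
- by move=> v l; rewrite labE => /andP[vZ /eqP ->]; split; rewrite ?id_lt // image_f.
- by rewrite size_image leq_add2l.
- exact: wB.
- apply: leq_trans MT; apply: leq_mul; last lia.
  by rewrite -[leqLHS]expn1 leq_exp2l //; lia.
exists K => //; split=> [v k /KS[u ku]|v u d uZ ud dm].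
  move: ku; rewrite labE => /andP[uZ /eqP e]; rewrite (eq_walk (arc_tag tag3)) => wk.
  by exists u.
by apply: (KC u v); rewrite ?labE ?uZ ?eqxx // (eq_walk (arc_tag tag3)).
Qed.

Section Tokens.

Variables (k0 k1 k2 : 'I_n -> seq nat).
Hypothesis kP0 : est_spec k0 0.
Hypothesis kP1 : est_spec k1 1.
Hypothesis kP2 : est_spec k2 2.

Let k v := est_of (k0 v) (k1 v) (k2 v).

Lemma kP tag : tag < 3 -> est_spec (fun v => k v tag) tag.
Proof. by case: tag => [|[|[|]]]. Qed.

Definition tok_of tag (u v : 'I_n) := quad M tag (id u) (id v) (omin n M (k v tag) (id u)).

Definition all_tokens : seq nat :=
  [seq tok_of p.1.1 p.1.2 p.2 | p <- [seq (q, v) | q <- [seq (tag, u) | tag <- iota 0 3, u <- enum Z], v <- enum Z]]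
  ++ [:: quad M 3 (id s) 0 0].

Definition tok_lab v := if landmark (inp v) (rnd v) then dist_tokens n M (inp v) (k v) else [::].

Lemma size_all_tokens : size all_tokens <= 3 * cap n * cap n + 1.
Proof.
rewrite size_cat size_map !size_allpairs [size [:: _]]/= leq_add2r -cardE size_iota.
by apply: leq_mul => //; apply: leq_mul.
Qed.

Lemma tok_labP v x : x \in tok_lab v <->
  (exists tag u, [/\ tag < 3, u \in Z, v \in Z, omin n M (k v tag) (id u) < n & x = tok_of tag u v])
  \/ (v = s /\ x = quad M 3 (id s) 0 0).
Proof.
rewrite /tok_lab; have -> : landmark (inp v) (rnd v) = (v \in Z) by rewrite inE.
rewrite /dist_tokens; split.
  case: ifP => // vZ; rewrite mem_cat => /orP[/allpairsPdep[tag [l [tg]]]|].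
    rewrite mem_filter => /andP[lt /mapP[y yk el]] ->; left.
    rewrite mem_iota in tg; have [S _] := kP tg; have [u [uZ eu _]] := S v y yk.
    by exists tag, u; rewrite /tok_of -eu -el.
  by rewrite [li_is_s _]/=; case: eqP => // -> /=; rewrite inE => /eqP ->; right.
case=> [[tag [u [tg uZ vZ lt ->]]]|[-> ->]]; last first.
  by rewrite s_in_Z mem_cat [li_is_s _]/= eqxx; apply/orP; right; rewrite inE.
rewrite vZ mem_cat; apply/orP; left; apply/allpairsPdep; exists tag, (id u).
rewrite mem_iota; split=> //; rewrite mem_filter lt /=; apply/mapP.
exists (omin n M (k v tag) (id u) * M + id u); last by rewrite modnMDl modn_small.
by have [/(_ lt)] := find_iota (fun o => o * M + id u \in k v tag) n.
Qed.

(** Detected lengths belong to actual walks, hence are never too small, and within the hop bound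
    they are not too large: links between near landmarks are exact. *)
Lemma omin_wmin tag u v d : tag < 3 -> u \in Z -> wmin (tag_rel tag) d u v -> d <= hops n ->
  omin n M (k v tag) (id u) = d.
Proof.
move=> tg uZ wm dm; have [S C] := kP tg; have [d' le kd] := C v u d uZ (proj1 wm) dm.
have lt := wmin_lt wm; rewrite card_ord in lt.
have [h1 h2] := find_iota (fun o => o * M + id u \in k v tag) n.
have le1 : omin n M (k v tag) (id u) <= d' by apply: h2 kd; apply: leq_ltn_trans lt.
apply/eqP; rewrite eqn_leq (leq_trans le1 le) /=; apply: (proj2 wm).
have /S[u' [_]] : omin n M (k v tag) (id u) * M + id u \in k v tag.
  by apply: h1; apply: leq_ltn_trans lt; apply: leq_trans le1 le.
rewrite modnMDl modn_small // => /id_inj <-.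
by rewrite divnMDl ?divn_small ?addn0 //; apply: leq_ltn_trans (id_lt u).
Qed.

Lemma omin_walk tag u v : tag < 3 -> omin n M (k v tag) (id u) < n ->
  walk (tag_rel tag) (omin n M (k v tag) (id u)) u v.
Proof.
move=> tg lt; have [S _] := kP tg.
have [/(_ lt)/S[u' [_ + +]] _] := find_iota (fun o => o * M + id u \in k v tag) n.
rewrite modnMDl modn_small // => /id_inj <-.
by rewrite divnMDl ?divn_small ?addn0 //; apply: leq_ltn_trans (id_lt u).
Qed.

Lemma n_gt0 : 0 < n.
Proof. by apply: leq_ltn_trans (ltn_ord s). Qed.

Lemma tok_ofE tag u v : tag < 3 ->
  [/\ quad1 M (tok_of tag u v) = tag, quad2 M (tok_of tag u v) = id u,
      quad3 M (tok_of tag u v) = id v & quad4 M (tok_of tag u v) = omin n M (k v tag) (id u)].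
Proof. by move=> tg; apply: quadE => //; lia. Qed.

Lemma tok_lab_ok v x : x \in tok_lab v -> x \in all_tokens /\ x < M ^ 4.
Proof.
have M0 : 0 < M by lia.
move/tok_labP=> [[tag [u [tg uZ vZ lt ->]]]|[_ ->]]; split.
- rewrite mem_cat; apply/orP; left; apply/mapP; exists (tag, u, v) => //.
  apply/allpairsP; exists ((tag, u), v); split; rewrite ?mem_enum //.
  by apply/allpairsP; exists (tag, u); split; rewrite ?mem_enum ?mem_iota.
- by apply: quad_lt => //; [lia | apply: ltn_trans n_lt].
- by rewrite mem_cat inE eqxx orbT.
- exact: quad_lt.
Qed.

Section Known.

Variable R : nat.
Variable kt : 'I_n -> seq nat.
Hypothesis reach : forall u v, exists2 d, walk (uadj E) d u v & d <= R.
Hypothesis ktP : sd_spec id (fun v => nbr_all (inp v)) (M ^ 4) tok_lab R kt.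

Let toks v := [seq x %% M ^ 4 | x <- kt v].

Lemma mem_toks v x : x \in toks v <-> exists u, x \in tok_lab u.
Proof.
have [S C] := ktP; split=> [/mapP[y yk ->]|[u xu]].
  by have [u ul _] := S v y yk; exists u.
have [d uv dR] := reach u v.
have [|d' _ yk] := C u v x d xu _ dR; first by rewrite (eq_walk (arc_nbr_all s t P irrE id_inj)).
apply/mapP; exists (d' * M ^ 4 + x) => //.
by have [_ lt] := tok_lab_ok xu; rewrite modnMDl modn_small.
Qed.

Lemma source_idE v : source_id M (toks v) = id s.
Proof.
rewrite /source_id; set l := [seq quad2 M x | x <- _].
have l_s y : y \in l -> y = id s.
  move=> /mapP[x]; rewrite mem_filter => /andP[/eqP x3 /mem_toks[u /tok_labP]] + ->.
  case=> [[tag [u' [tg _ _ _ ex]]]|[_ ->]].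
    by have [e _ _ _] := tok_ofE u' u tg; rewrite ex e in x3; rewrite x3 in tg.
  by have [|||_ -> _ _] := @quadE M 3 (id s) 0 0 => //; lia.
have : id s \in l.
  apply/mapP; exists (quad M 3 (id s) 0 0); last by have [|||_ -> _ _] := @quadE M 3 (id s) 0 0 => //; lia.
  rewrite mem_filter; apply/andP; split; last by apply/mem_toks; exists s; apply/tok_labP; right.
  by have [|||-> _ _ _] := @quadE M 3 (id s) 0 0 => //; lia.
by case: l l_s => // y l h _; apply: h; rewrite inE eqxx.
Qed.

Lemma triplesP v tag l l' o : tag < 3 -> (l, l', o) \in triples M (toks v) tag <->
  exists u u', [/\ u \in Z, u' \in Z, omin n M (k u' tag) (id u) < n &
                  (l, l', o) = (id u, id u', omin n M (k u' tag) (id u))].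
Proof.
move=> tg; split.
  case/mapP=> x; rewrite mem_filter => /andP[/eqP xt /mem_toks[u' /tok_labP]].
  case=> [[tag' [u [tg' uZ u'Z lt ex]]]|[_ ex]].
    have [e1 e2 e3 e4] := tok_ofE u u' tg'; rewrite ex in xt *; rewrite e1 in xt.
    by rewrite e2 e3 e4 -xt; exists u, u'; rewrite -?xt.
  by move: tg; rewrite -xt ex; have [|||-> _ _ _] := @quadE M 3 (id s) 0 0 => //; lia.
case=> u [u' [uZ u'Z lt ->]]; apply/mapP; exists (tok_of tag u u').
  have [e _ _ _] := tok_ofE u u' tg; rewrite mem_filter e eqxx /=; apply/mem_toks; exists u'.
  by apply/tok_labP; left; exists tag, u.
by have [_ -> -> ->] := tok_ofE u u' tg.
Qed.

Lemma dist_sound v tag u : tag < 3 ->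
  ldist M (triples M (toks v) tag) (k v tag) n (id u) < n ->
  walk (tag_rel tag) (ldist M (triples M (toks v) tag) (k v tag) n (id u)) u v.
Proof.
move=> tg; have [S _] := kP tg; apply: ldist_sound => //.
  move=> l l' o /(triplesP _ _ _ _ tg)[u1 [u2 [_ _ lt [-> -> ->]]]].
  by exists u1, u2; split=> //; apply: omin_walk.
by move=> x /S[u1 [_ e w1]]; exists u1.
Qed.

Lemma dist_complete v tag u d : tag < 3 -> u \in Z -> walk (tag_rel tag) d u v ->
  ldist M (triples M (toks v) tag) (k v tag) n (id u) <= d.
Proof.
move=> tg; have [S C] := kP tg.
apply: (@ldist_complete _ _ (tag_rel tag) Z _ (hops n)) => //.
- move=> l l' o /(triplesP _ _ _ _ tg)[u1 [u2 [_ _ lt [-> -> ->]]]].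
  by exists u1, u2; split=> //; apply: omin_walk.
- move=> u1 u2 d' u1Z u2Z wm dm; apply/(triplesP _ _ _ _ tg); exists u1, u2.
  have e := omin_wmin tg u1Z wm dm; rewrite e; split=> //.
  by have := wmin_lt wm; rewrite card_ord.
- by move=> x /S[u1 [_ e w1]]; exists u1.
- by move=> u1 d' u1Z; apply: C.
- exact: Zhits.
Qed.

Lemma mem_landmark_ids v l : l \in landmark_ids M (toks v) <-> exists2 u, u \in Z & l = id u.
Proof.
rewrite mem_filter mem_iota /=; split.
  case/andP=> /hasP[x /mem_toks[u' /tok_labP] + /andP[/eqP x1 /eqP <-]] _.
  case=> [[tag [u [tg uZ _ _ ->]]]|[_ ex]].
    by have [_ -> _ _] := tok_ofE u u' tg; exists u.
  by rewrite ex in x1; have [|||e _ _ _] := @quadE M 3 (id s) 0 0 => //; try lia; rewrite e in x1.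
case=> u uZ ->; rewrite id_lt andbT; apply/hasP; exists (tok_of 1 u u); last first.
  by have [-> -> _ _] := tok_ofE u u (isT : 1 < 3); rewrite !eqxx.
apply/mem_toks; exists u; apply/tok_labP; left; exists 1, u; split=> //.
rewrite (@omin_wmin 1 u u 0) ?n_gt0 //.
by split=> //=.
Qed.

End Known.

End Tokens.

Lemma runs_learn : exists kn R T,
  [/\ runs E id B T (fun v => learn ie (inp v) (rnd v)) kn, learn_spec kn R, R <= 3 * D.+1, R <= 3 * n &
      T <= R + 3 * (hops n + cap n) + (R + (3 * cap n * cap n + 1))].
Proof.
have arcU := arc_nbr_all s t P irrE id_inj.
have symU : symmetric (arc id (fun v => nbr_all (inp v))) by move=> u v; rewrite !arcU uadj_sym.
have conn : forall v, exists d, walk (arc id (fun v => nbr_all (inp v))) d s v.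
  by move=> v; have [d sv _] := uadj_walk diam s v; exists d; rewrite (eq_walk arcU).
have [k0 run0 kP0] := runs_est (isT : 0 < 3).
have [k1 run1 kP1] := runs_est (isT : 1 < 3).
have [k2 run2 kP2] := runs_est (isT : 2 < 3).
pose R := ecc_radius conn.
have Rn : R <= 3 * n := ecc_radius_le_order conn.
have n2w : n < 2 ^ w.
  apply: leq_trans MT; apply: (@leq_trans (1 * (3 * n + 1))); first by have := n_gt0; lia.
  by apply: leq_mul; [rewrite expn_gt0; lia | lia].
have runR := runs_ecc id_inj (nbr_all_adj irrE) symU conn wB n2w.
have [||||kt runT ktP] := @runs_sd n E id B (fun v => nbr_all (inp v)) id_inj
   (nbr_all_adj irrE) (M ^ 4) (tok_lab k0 k1 k2) (all_tokens k0 k1 k2) R (R + (3 * cap n * cap n + 1)) w.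
- by move=> v l; apply: tok_lab_ok.
- by rewrite leq_add2l size_all_tokens.
- exact: wB.
- by apply: leq_trans MT; rewrite leq_mul2l; lia.
have reach u v : exists2 d, walk (uadj E) d u v & d <= R.
  by have [d uv le] := ecc_radius_ge symU conn u v; exists d => //; rewrite -(eq_walk arcU).
pose toks v := [seq x %% M ^ 4 | x <- kt v].
pose dist v tag := ldist M (triples M (toks v) tag) (est_of (k0 v) (k1 v) (k2 v) tag) n.
exists (fun v => Knowledge R (dist v 0 (source_id M (toks v))) (landmark_ids M (toks v)) (dist v 1) (dist v 2)).
exists R, (R + ((hops n + cap n) + ((hops n + cap n) + ((hops n + cap n) + (R + (3 * cap n * cap n + 1) + 0))))).
split; [ | | | exact: Rn | lia]; last first.
- by apply: ecc_radius_le => u v; have [d uv le] := uadj_walk diam u v; exists d; rewrite ?(eq_walk arcU).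
- split=> //=.
  (* The distance from [s] is at most [i] along [P], and at least [i] because [P] is shortest. *)
  + move=> i ih; rewrite /dist (source_idE kP0 kP1 kP2 reach ktP).
    have le : ldist M (triples M (toks (pvert i)) 0) (k0 (pvert i)) n (id s) <= i.
      apply: (dist_complete kP0 kP1 kP2 reach ktP (tag := 0)) => //; first exact: s_in_Z.
      rewrite -[X in walk _ X]subn0 -[X in walk _ _ X](pvert0 s P).
      by apply: (walk_pvertE shortest (i := 0)); rewrite ih.
    have lt : i < n.
      have := uniq_pvert shortest => /card_uniqP /= e.
      by have := max_card (mem (s :: P)); rewrite e card_ord; lia.
    apply/eqP; rewrite eqn_leq le -[X in _ <= X]add0n.
    apply: (pvert_dist shortest (a := 0)) => //.
    by apply: (dist_sound kP0 kP1 kP2 reach ktP (tag := 0)) => //; apply: leq_ltn_trans lt.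
  + have lmE v l := mem_landmark_ids kP0 kP1 kP2 reach ktP v l.
    exists (landmark_ids M (toks s)); split=> [v||l]; last exact: lmE.
      apply/eq_in_filter => l; rewrite mem_iota /= => lM; have := lmE v l; have := lmE s l.
      rewrite /landmark_ids !mem_filter !mem_iota /= lM !andbT => h1 h2.
      by apply/idP/idP => [/h2/h1|/h1/h2].
    rewrite (leq_trans _ Zcap) // cardE -(size_map id); apply: uniq_leq_size.
      by rewrite filter_uniq ?iota_uniq.
    by move=> l /lmE[u uZ ->]; rewrite map_f ?mem_enum.
  + by move=> v u uZ; apply: (dist_sound kP0 kP1 kP2 reach ktP (tag := 1)).
  + by move=> v u d uZ; apply: (dist_complete kP0 kP1 kP2 reach ktP (tag := 1)).
  + move=> v u uZ lt; rewrite -walk_rev.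
    by apply: (dist_sound kP0 kP1 kP2 reach ktP (tag := 2)).
  + move=> v u d uZ; rewrite -walk_rev.
    by apply: (dist_complete kP0 kP1 kP2 reach ktP (tag := 2)).
rewrite /learn; apply: (runs_bind runR); apply: (runs_bind run0); apply: (runs_bind run1).
by apply: (runs_bind run2); apply: (runs_bind runT).
Qed.

End Learn.

(** * Combining the detours *)

Definition inf n := 4 * n.

(* Costs are kept as [a + d + (n - b)] for a detour of length [d] from the [a]-th
   to the [b]-th vertex of [P], so that no subtraction is truncated. *)
Definition detour_entry n (onp : bool) i r := if onp && (r == 0) then n - i else inf n.

(** Here [y d] is [n - b] for the largest end b reached in [d] steps. What is injected in round [r]
    will be read in round [m.-1], at index [i + (m.-1 - r)]; the filter keeps exactly the ends
    strictly beyond that reader. *)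
Definition land_entry n m (onp : bool) i (y : nat -> nat) r :=
  if onp then foldr minn (inf n) [seq d + i + y d | d <- iota 0 m.+1 & y d + i + (m - r) <= n]
  else inf n.

Definition to_item n (onp : bool) i (dist : nat -> nat) l :=
  if onp && (dist l < n) then i + dist l else inf n.

Definition from_item n (onp : bool) i (dist : nat -> nat) l :=
  if onp && (dist l < n) then n - i + dist l else inf n.

(** The last vertex of a segment announces its best starts, the first one its best ends, and [t] the
    length of [P]. A truncated final segment announces no starts, but no later segment would read
    them. *)
Definition seg_tokens n M m (I : local_input) i (lms : seq nat) (yA yB : nat -> nat) : seq nat :=
  (if on_path I && (i %% m == m.-1) then
     [seq quad M 0 (nth 0 lms j) (i %/ m) (yA j) | j <- [seq j <- iota 0 (size lms) | yA j < inf n]]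
   else [::]) ++
  (if on_path I && (i %% m == 0) then
     [seq quad M 1 (nth 0 lms j) (i %/ m) (yB j) | j <- [seq j <- iota 0 (size lms) | yB j < inf n]]
   else [::]) ++
  (if li_is_t I then [:: quad M 2 0 0 i] else [::]).

Definition best_to M m i (toks : seq nat) l (yA : nat) : nat :=
  foldr minn yA [seq quad4 M x | x <- toks & [&& quad1 M x == 0, quad2 M x == l & quad3 M x < i %/ m]].

Definition best_from M m i (toks : seq nat) l (zB : nat) : nat :=
  foldr minn zB [seq quad4 M x | x <- toks & [&& quad1 M x == 1, quad2 M x == l & i %/ m < quad3 M x]].

Definition path_length M (toks : seq nat) : nat :=
  head 0 [seq quad4 M x | x <- toks & quad1 M x == 2].

Definition best_cost n (J short : nat) (A B : nat -> nat) : nat :=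
  foldr minn short [seq A j + B j | j <- iota 0 J & (A j < inf n) && (B j < inf n)].

Definition finish n M m i (lms : seq nat) short (yA zB : nat -> nat) (toks : seq nat) : option nat :=
  let best := best_cost n (size lms) short
    (fun j => best_to M m i toks (nth 0 lms j) (yA j))
    (fun j => best_from M m i toks (nth 0 lms j) (zB j)) in
  if best < inf n then Some (best + path_length M toks - n) else None.

(** At offset 0 a vertex listens to nobody, which cuts [P] into segments. A start may be [i] itself,
    so [yA] includes the own item; an end must exceed [i], so [finish] gets only the history [zB].
    The own item enters [yB], whose tokens are read in earlier segments only. *)
Definition answer ie (I : local_input) (kn : knowledge) : prog (option nat) :=
  let n := li_n I in let M := base ie n in let m := hops n in let INF := inf n in
  let onp := on_path I in let i := kn_index kn in
  let lms := kn_landmarks kn in let J := size lms in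
  let prev := seq_of_opt (li_P_prev I) in let next := seq_of_opt (li_P_next I) in
  let oA := i %% m in let oB := m.-1 - i %% m in
  let vA j := to_item n onp i (kn_to kn) (nth 0 lms j) in
  let vB j := from_item n onp i (kn_from kn) (nth 0 lms j) in
  bind (pipe (nbr_in 2 I) INF (detour_entry n onp i) m) (fun zf =>
  let land := land_entry n m onp i (fun d => minn (detour_entry n onp i d) (nth INF zf d)) in
  bind (pipe prev INF land m.-1) (fun zg =>
  bind (pipe (if oA == 0 then [::] else prev) INF (scan_entry INF J oA vA) (m + cap n)) (fun zA =>
  bind (pipe (if oB == 0 then [::] else next) INF (scan_entry INF J oB vB) (m + cap n)) (fun zB =>
  let yA j := minn (vA j) (nth INF zA (oA + j)) in
  let yB j := minn (vB j) (nth INF zB (oB + j)) in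
  bind (sd (nbr_all I) (M ^ 4) (kn_radius kn + (2 * (n %/ m).+1 * cap n + 1))
          (seg_tokens n M m I i lms yA yB)) (fun kt =>
  Ret (finish n M m i lms (minn (land m.-1) (nth INF zg m.-1)) yA
         (fun j => nth INF zB (oB + j)) [seq x %% M ^ 4 | x <- kt])))))).

Lemma modn_succ_block q a k b : a <= k -> k < b -> a %/ q = b %/ q -> k.+1 %% q = (k %% q).+1.
Proof.
move=> ak kb e.
have h1 := leq_div2r q ak; have h2 := leq_div2r q kb; have h3 := leq_div2r q (leqnSn k).
have e1 : k %/ q = b %/ q by lia.
have e2 : k.+1 %/ q = b %/ q by lia.
have := divn_eq k.+1 q; have := divn_eq k q; rewrite e1 e2; lia.
Qed.

Section Answer.

Variables (ie n : nat) (E : rel 'I_n) (id : 'I_n -> nat) (s t : 'I_n) (P : seq 'I_n) (B : nat).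
Hypothesis irrE : irreflexive E.
Hypothesis id_inj : injective id.
Hypothesis shortest : is_shortest_path E s P t.
Hypothesis P_gt0 : 0 < size P.

Local Notation inp := (local_inputs E id s t P).
Local Notation pvert := (pvert s P).
Local Notation pedge := (pedge s P).
Local Notation offpath := (offpath E s P).
Local Notation M := (base ie n).
Local Notation m := (hops n).
Local Notation INF := (inf n).

Variables (rnd : 'I_n -> seq bool) (kn : 'I_n -> knowledge) (R : nat).
Local Notation Z := (Z E id s t P rnd).
Hypothesis knP : learn_spec E id s t P rnd kn R.
Hypothesis id_lt : forall u, id u < M.
Hypothesis inf_lt : INF < M.
Hypothesis M_gt : 3 < M.
Hypothesis Zhits : hits offpath Z m.
Variable lms : seq nat.
Hypothesis kn_lms : forall v, kn_landmarks (kn v) = lms.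
Hypothesis lms_cap : size lms <= cap n.
Hypothesis lmsP : forall l, l \in lms <-> exists2 u, u \in Z & l = id u.
Variable w : nat.
Hypothesis wB : (2 * w).+1 <= B.
Hypothesis MT : M ^ 4 * (R + (2 * (n %/ m).+1 * cap n + 1)) <= 2 ^ w.

Local Notation idx v := (kn_index (kn v)).
Local Notation onp v := (on_path (inp v)).

Lemma P_lt : size P < n.
Proof.
have := uniq_pvert shortest => /card_uniqP /= e.
by have := max_card (mem (s :: P)); rewrite e card_ord.
Qed.

Lemma m_gt0 : 0 < m.
Proof. by rewrite /hops muln_gt0 expn_gt0 addn_gt0 orbT. Qed.

Lemma onp_pvert i : i <= size P -> onp (pvert i).
Proof. by move=> ih; apply/(on_pathP id_inj shortest) => //; exists i. Qed.

Lemma idx_pvert i : i <= size P -> idx (pvert i) = i.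
Proof. exact: (ls_index knP). Qed.

Lemma offpath_E : subrel offpath E.
Proof. by move=> u v /andP[]. Qed.

Lemma offpath_dist a b d : a <= size P -> b <= size P ->
  walk offpath d (pvert a) (pvert b) -> b <= a + d.
Proof. by move=> ah bh /(sub_walk offpath_E); apply: (pvert_dist shortest). Qed.

Lemma pedge_inv (Q : rel 'I_n) d u i : subrel Q pedge -> i <= size P -> walk Q d u (pvert i) ->
  d <= i /\ u = pvert (i - d).
Proof.
move=> sQ; elim: d i => [|d IH] i ih; first by move=> /eqP->; rewrite subn0.
case/walk_inv=> x ux /sQ /pedgeP[j jh [ex /(pvert_inj shortest)]].
move=> /(_ ih jh) ei; rewrite ex in ux; have [dj ->] := IH j (ltnW jh) ux.
by rewrite ei subSS.
Qed.

Lemma pedge_rev_inv (Q : rel 'I_n) d u i : subrel Q (fun x y => pedge y x) -> i <= size P ->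
  walk Q d u (pvert i) -> i + d <= size P /\ u = pvert (i + d).
Proof.
move=> sQ; elim: d i => [|d IH] i ih; first by move=> /eqP->; rewrite addn0.
case/walk_inv=> x ux /sQ /pedgeP[j jh [/(pvert_inj shortest) + ex]].
move=> /(_ ih (ltnW jh)) ei; rewrite ex in ux; have [dj ->] := IH j.+1 jh ux.
by rewrite ei addSnnS in dj *.
Qed.

Lemma pedge_pvert i : i < size P -> pedge (pvert i) (pvert i.+1).
Proof. by move=> ih; apply/pedgeP; exists i. Qed.

(** * Short detours: flooding along H and pushing along the path *)

Section Detour.

Variable zf : 'I_n -> seq nat.
Hypothesis zfP :
  pipe_spec id (fun v => nbr_in 2 (inp v)) INF (fun v => detour_entry n (onp v) (idx v)) m zf.

Let yf v d := minn (detour_entry n (onp v) (idx v) d) (nth INF (zf v) d).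

Lemma detour_sound v d : d <= m -> yf v d < INF ->
  exists b, [/\ b <= size P, walk offpath d v (pvert b) & yf v d = n - b].
Proof.
move=> dm lt; have [u [e [ed wk eq]]] := pipe_val_sound zfP dm lt.
move: lt; rewrite [yf v d]eq /detour_entry; case: ifP => [/andP[ou /eqP r0] _|_]; last by rewrite ltnn.
have [b bh eu] := on_pathP id_inj shortest u P_gt0 ou.
exists b; rewrite eu idx_pvert //; split=> //.
have -> : d = e by lia.
by move: wk; rewrite (eq_walk (arc_nbr_in2 id_inj shortest)) walk_rev eu.
Qed.

Lemma detour_complete v b d : d <= m -> b <= size P -> walk offpath d v (pvert b) -> yf v d <= n - b.
Proof.
move=> dm bh wk.
have := pipe_val_complete (u := pvert b) (v := v) zfP dm (leqnn d).
rewrite (eq_walk (arc_nbr_in2 id_inj shortest)) walk_rev => /(_ wk).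
by rewrite subnn /detour_entry onp_pvert // idx_pvert.
Qed.

Variable zg : 'I_n -> seq nat.
Let land v := land_entry n m (onp v) (idx v) (yf v).
Hypothesis zgP : pipe_spec id (fun v => seq_of_opt (li_P_prev (inp v))) INF land m.-1 zg.

Let short v := minn (land v m.-1) (nth INF (zg v) m.-1).

Lemma short_sound i : i <= size P -> short (pvert i) < INF ->
  exists a b d, [/\ a <= i < b, b <= size P, walk offpath d (pvert a) (pvert b) &
                    short (pvert i) = a + d + (n - b)].
Proof.
move=> ih lt; have [u [e [em wk eq]]] := pipe_val_sound zgP (leqnn _) lt.
move: lt; rewrite [short _]eq /land /land_entry.
have sQ : subrel (arc id (fun v => seq_of_opt (li_P_prev (inp v)))) pedge.
  by move=> x y; rewrite (arc_prev id_inj shortest).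
have [ei ->] := pedge_inv sQ ih wk.
have ah : i - e <= size P by lia.
rewrite onp_pvert // idx_pvert // => /foldr_minn_in /mapP[d].
rewrite mem_filter mem_iota add0n ltnS => /andP[c /andP[_ dm]] ->.
have m0 := m_gt0; have Pn := P_lt.
have [|b [bh wd e2]] := detour_sound (v := pvert (i - e)) dm; first by rewrite /inf; lia.
(* The entry was injected in round [m.-1 - e], so [c] says [(i - e) + e.+1 <= b], that is
   [i < b]. *)
exists (i - e), b, d; rewrite e2 in c *; split=> //; lia.
Qed.

Lemma short_complete a b d i : a <= i < b -> b <= size P -> walk offpath d (pvert a) (pvert b) ->
  d <= m -> short (pvert i) <= a + d + (n - b).
Proof.
move=> /andP[ai ib] bh wd dm; have m0 := m_gt0; have Pn := P_lt.
have ah : a <= size P by lia.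
(* From [i < b <= a + d <= a + m] the start lies at most [m.-1] edges before [v_i]. *)
have bd := offpath_dist ah bh wd.
have le : i - a <= m.-1 by lia.
have wk : walk (arc id (fun v => seq_of_opt (li_P_prev (inp v)))) (i - a) (pvert a) (pvert i).
  rewrite (eq_walk (arc_prev id_inj shortest)).
  by apply: walk_pvert => [|k kk]; [lia | apply: pedge_pvert; lia].
apply: leq_trans (pipe_val_complete zgP (leqnn _) le wk) _.
rewrite /land /land_entry onp_pvert // idx_pvert //.
(* The end recorded for [v_a] and [d] is at or beyond [v_b], so it passes the filter and costs no
   more. *)
have yd := detour_complete dm bh wd.
apply: (@leq_trans (d + a + yf (pvert a) d)); last by lia.
apply: foldr_minn_le; apply/mapP; exists d => //.
by rewrite mem_filter mem_iota; lia.
Qed.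

End Detour.

(** * Long detours: scans inside segments and tokens between them *)

Let oA v := idx v %% m.
Let vA v j := to_item n (onp v) (idx v) (kn_to (kn v)) (nth 0 lms j).
Let nbA v := if oA v == 0 then [::] else seq_of_opt (li_P_prev (inp v)).
Let oB v := m.-1 - idx v %% m.
Let vB v j := from_item n (onp v) (idx v) (kn_from (kn v)) (nth 0 lms j).
Let nbB v := if oB v == 0 then [::] else seq_of_opt (li_P_next (inp v)).

Lemma arcA u v : arc id nbA u v = pedge u v && (oA v != 0).
Proof. by rewrite /arc /nbA; case: ifP => _; rewrite ?andbF // andbT -(arc_prev id_inj shortest). Qed.

Lemma arcB u v : arc id nbB u v = pedge v u && (oB v != 0).
Proof. by rewrite /arc /nbB; case: ifP => _; rewrite ?andbF // andbT -(arc_next id_inj shortest). Qed.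

Lemma oA_arc u v : arc id nbA u v -> oA v = (oA u).+1.
Proof.
rewrite arcA => /andP[/pedgeP[j jh [-> ->]]].
rewrite /oA !idx_pvert ?(ltnW jh) // modnS.
by case: ifP.
Qed.

Lemma oB_arc u v : arc id nbB u v -> oB v = (oB u).+1.
Proof.
rewrite arcB => /andP[/pedgeP[j jh [-> ->]]].
rewrite /oB !idx_pvert ?(ltnW jh) //; have := ltn_pmod j m_gt0; rewrite modnS.
case: ifP => [|_]; last by lia.
rewrite -addn1 /dvdn -modnDml; have := ltn_pmod j m_gt0.
move: (j %% m) => r rm; case: (ltngtP r m.-1) => [lt||->]; try lia.
by rewrite modn_small; lia.
Qed.

Lemma walkA a i : a <= i <= size P -> a %/ m = i %/ m -> walk (arc id nbA) (i - a) (pvert a) (pvert i).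
Proof.
move=> ai e; apply: walk_pvert => // k /andP[ak ki]; rewrite arcA pedge_pvert /=; last lia.
rewrite /oA idx_pvert; last lia.
by rewrite (modn_succ_block ak ki e).
Qed.

Lemma walkB b i : i <= b <= size P -> b %/ m = i %/ m -> walk (arc id nbB) (b - i) (pvert b) (pvert i).
Proof.
move=> ib e; rewrite -walk_rev; apply: walk_pvert => // k /andP[ik kb]; rewrite arcB pedge_pvert /=; last lia.
rewrite /oB idx_pvert; last lia.
have := ltn_pmod k.+1 m_gt0; rewrite (modn_succ_block ik kb (esym e)).
by move: (k %% m) m => r q; lia.
Qed.

Section Scans.

Variables zA zB : 'I_n -> seq nat.
Hypothesis zAP : pipe_spec id nbA INF (fun v => scan_entry INF (size lms) (oA v) (vA v)) (m + cap n) zA.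
Hypothesis zBP : pipe_spec id nbB INF (fun v => scan_entry INF (size lms) (oB v) (vB v)) (m + cap n) zB.

Let yA v j := minn (vA v j) (nth INF (zA v) (oA v + j)).
Let cB v j := nth INF (zB v) (oB v + j).
Let yB v j := minn (vB v j) (cB v j).

Lemma vA_pvert a j : a <= size P -> kn_to (kn (pvert a)) (nth 0 lms j) < n ->
  vA (pvert a) j = a + kn_to (kn (pvert a)) (nth 0 lms j).
Proof. by move=> ah lt; rewrite /vA /to_item onp_pvert // idx_pvert // lt. Qed.

Lemma vB_pvert b j : b <= size P -> kn_from (kn (pvert b)) (nth 0 lms j) < n ->
  vB (pvert b) j = n - b + kn_from (kn (pvert b)) (nth 0 lms j).
Proof. by move=> bh lt; rewrite /vB /from_item onp_pvert // idx_pvert // lt. Qed.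

Lemma vA_lt a j : a <= size P -> vA (pvert a) j < INF ->
  kn_to (kn (pvert a)) (nth 0 lms j) < n.
Proof.
move=> ah; rewrite /vA /to_item onp_pvert //.
by case: (ltnP _ n) => //= _; rewrite ltnn.
Qed.

Lemma vB_lt b j : b <= size P -> vB (pvert b) j < INF ->
  kn_from (kn (pvert b)) (nth 0 lms j) < n.
Proof.
move=> bh; rewrite /vB /from_item onp_pvert //.
by case: (ltnP _ n) => //= _; rewrite ltnn.
Qed.

Lemma oA_le v j : j < size lms -> oA v + j <= m + cap n.
Proof.
by move=> jJ; apply: leq_add; [apply: ltnW; apply: ltn_pmod m_gt0 | apply: leq_trans lms_cap; apply: ltnW].
Qed.

Lemma oB_le v j : j < size lms -> oB v + j <= m + cap n.
Proof.
move=> jJ; apply: leq_add; last by apply: leq_trans lms_cap; apply: ltnW.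
by rewrite /oB; lia.
Qed.

Lemma yA_sound i j : i <= size P -> j < size lms -> yA (pvert i) j < INF ->
  exists a, [/\ a <= i, kn_to (kn (pvert a)) (nth 0 lms j) < n &
                yA (pvert i) j = a + kn_to (kn (pvert a)) (nth 0 lms j)].
Proof.
move=> ih jJ; rewrite /yA; case: (leqP (vA (pvert i) j)) => _ lt.
  have lt' := vA_lt ih lt; exists i; split=> //; exact: vA_pvert.
have [u [d [_ wk eq]]] := scan_sound oA_arc zAP (oA_le _ jJ) lt.
have [|di eu] := pedge_inv _ ih wk; first by move=> x y; rewrite arcA => /andP[].
have ah : i - d <= size P by lia.
rewrite eq eu in lt *; have lt' := vA_lt ah lt.
by exists (i - d); split=> //; [lia | apply: vA_pvert].
Qed.

Lemma yA_complete a i j : a <= i <= size P -> a %/ m = i %/ m -> j < size lms ->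
  kn_to (kn (pvert a)) (nth 0 lms j) < n ->
  yA (pvert i) j <= a + kn_to (kn (pvert a)) (nth 0 lms j).
Proof.
move=> /andP[ai ih] e jJ lt; rewrite -vA_pvert ?(leq_trans ai) //.
move: ai; rewrite leq_eqVlt => /predU1P[->|ai]; first exact: geq_minl.
apply: leq_trans (geq_minr _ _) _.
apply: (scan_complete oA_arc zAP (oA_le _ jJ) jJ (d := i - a)); first by lia.
by apply: walkA e; rewrite ltnW.
Qed.

Lemma cB_sound i j : i <= size P -> j < size lms -> cB (pvert i) j < INF ->
  exists b, [/\ i < b <= size P, kn_from (kn (pvert b)) (nth 0 lms j) < n &
                cB (pvert i) j = n - b + kn_from (kn (pvert b)) (nth 0 lms j)].
Proof.
move=> ih jJ lt; have [u [d [d0 wk eq]]] := scan_sound oB_arc zBP (oB_le _ jJ) lt.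
have [|di eu] := pedge_rev_inv _ ih wk; first by move=> x y; rewrite arcB => /andP[].
rewrite /cB eq eu in lt *; have lt' := vB_lt di lt.
by exists (i + d); split=> //; [lia | apply: vB_pvert].
Qed.

Lemma cB_complete b i j : i < b <= size P -> b %/ m = i %/ m -> j < size lms ->
  kn_from (kn (pvert b)) (nth 0 lms j) < n ->
  cB (pvert i) j <= n - b + kn_from (kn (pvert b)) (nth 0 lms j).
Proof.
move=> /andP[ib bh] e jJ lt; rewrite -vB_pvert //.
apply: (scan_complete oB_arc zBP (oB_le _ jJ) jJ (d := b - i)); first by lia.
by apply: walkB e; rewrite ltnW.
Qed.

Lemma yB_sound i j : i <= size P -> j < size lms -> yB (pvert i) j < INF ->
  exists b, [/\ i <= b <= size P, kn_from (kn (pvert b)) (nth 0 lms j) < n &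
                yB (pvert i) j = n - b + kn_from (kn (pvert b)) (nth 0 lms j)].
Proof.
move=> ih jJ; rewrite /yB; case: (leqP (vB (pvert i) j)) => _ lt.
  have lt' := vB_lt ih lt; exists i; split; rewrite ?leqnn //; exact: vB_pvert.
have [b [/andP[ib bh] lt' e]] := cB_sound ih jJ lt.
by exists b; rewrite (ltnW ib).
Qed.

Lemma yB_complete b i j : i <= b <= size P -> b %/ m = i %/ m -> j < size lms ->
  kn_from (kn (pvert b)) (nth 0 lms j) < n ->
  yB (pvert i) j <= n - b + kn_from (kn (pvert b)) (nth 0 lms j).
Proof.
move=> /andP[ib bh] e jJ lt; move: ib; rewrite leq_eqVlt => /predU1P[eib|ib].
  by rewrite eib -vB_pvert // geq_minl.
by apply: leq_trans (geq_minr _ _) _; apply: cB_complete; rewrite ?ib.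
Qed.

Let tok_lab2 v := seg_tokens n M m (inp v) (idx v) lms (yA v) (yB v).

Definition seg_token (tag q j : nat) : nat :=
  if tag == 0 then quad M 0 (nth 0 lms j) q (yA (pvert (q * m + m.-1)) j)
  else quad M 1 (nth 0 lms j) q (yB (pvert (q * m)) j).

Definition all_seg_tokens : seq nat :=
  [seq seg_token p.1.1 p.1.2 p.2
     | p <- [seq (q, j) | q <- [seq (tag, q) | tag <- iota 0 2, q <- iota 0 (n %/ m).+1], j <- iota 0 (size lms)]]
  ++ [:: quad M 2 0 0 (size P)].

Lemma size_all_seg_tokens : size all_seg_tokens <= 2 * (n %/ m).+1 * cap n + 1.
Proof.
rewrite size_cat size_map !size_allpairs [size [:: _]]/= leq_add2r !size_iota.
exact: leq_mul.
Qed.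

Lemma tok_lab2P v x : x \in tok_lab2 v <->
  [\/ exists i j, [/\ i <= size P, v = pvert i, i %% m = m.-1, j < size lms /\ yA v j < INF &
                      x = quad M 0 (nth 0 lms j) (i %/ m) (yA v j)],
      exists i j, [/\ i <= size P, v = pvert i, i %% m = 0, j < size lms /\ yB v j < INF &
                      x = quad M 1 (nth 0 lms j) (i %/ m) (yB v j)] |
      v = t /\ x = quad M 2 0 0 (size P)].
Proof.
have idx_t : idx t = size P by rewrite -(pvert_last shortest) idx_pvert.
rewrite /tok_lab2 /seg_tokens !mem_cat; split.
  case/or3P.
  - case: ifP => // /andP[/(on_pathP id_inj shortest v P_gt0)[i ih ev]].
    rewrite {1 2}ev idx_pvert // => /eqP im /mapP[j]; rewrite mem_filter mem_iota => /andP[lt jJ] ->.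
    by constructor 1; exists i, j.
  - case: ifP => // /andP[/(on_pathP id_inj shortest v P_gt0)[i ih ev]].
    rewrite {1 2}ev idx_pvert // => /eqP im /mapP[j]; rewrite mem_filter mem_iota => /andP[lt jJ] ->.
    by constructor 2; exists i, j.
  rewrite [li_is_t _]/=; case: eqP => // -> ; rewrite inE => /eqP ->.
  by constructor 3; rewrite idx_t.
case=> [[i [j [ih ev im [jJ lt] ->]]]|[i [j [ih ev im [jJ lt] ->]]]|[-> ->]].
- have [-> ->] : onp v /\ idx v = i by rewrite ev onp_pvert ?idx_pvert.
  apply/or3P; constructor 1; rewrite im eqxx; apply/mapP; exists j => //.
  by rewrite mem_filter mem_iota lt.
- have [-> ->] : onp v /\ idx v = i by rewrite ev onp_pvert ?idx_pvert.
  apply/or3P; constructor 2; rewrite im eqxx; apply/mapP; exists j => //.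
  by rewrite mem_filter mem_iota lt.
by apply/or3P; constructor 3; rewrite [li_is_t _]/= eqxx inE idx_t.
Qed.

Lemma lms_nth j : j < size lms -> exists2 u, u \in Z & nth 0 lms j = id u.
Proof. by move=> jJ; apply/lmsP/mem_nth. Qed.

Lemma tok_lab2_ok v x : x \in tok_lab2 v -> x \in all_seg_tokens /\ x < M ^ 4.
Proof.
have n4 : n < M by move: inf_lt; rewrite /inf; lia.
have Pn := P_lt; have M0 : 0 < M by lia.
have seg_lt i : i <= size P -> i %/ m < M.
  by move=> ih; apply: leq_ltn_trans (leq_div _ _) _; lia.
have segn i : i <= size P -> i %/ m <= n %/ m by move=> ih; apply: leq_div2r; lia.
case/tok_lab2P=> [[i [j [ih ev im [jJ lt] ->]]]|[i [j [ih ev im [jJ lt] ->]]]|[_ ->]].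
- have [u _ eu] := lms_nth jJ; split; last first.
    by apply: quad_lt; rewrite ?eu ?seg_lt //; apply: ltn_trans inf_lt.
  rewrite mem_cat; apply/orP; left; apply/mapP; exists (0, i %/ m, j).
    apply/allpairsP; exists ((0, i %/ m), j); split; rewrite ?mem_iota //.
    by apply/allpairsP; exists (0, i %/ m); split; rewrite ?mem_iota //= add0n ltnS segn.
  by rewrite /seg_token /= -im -divn_eq -ev.
- have [u _ eu] := lms_nth jJ; split; last first.
    by apply: quad_lt; rewrite ?eu ?seg_lt //; [lia | apply: ltn_trans inf_lt].
  rewrite mem_cat; apply/orP; left; apply/mapP; exists (1, i %/ m, j).
    apply/allpairsP; exists ((1, i %/ m), j); split; rewrite ?mem_iota //.
    by apply/allpairsP; exists (1, i %/ m); split; rewrite ?mem_iota //= add0n ltnS segn.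
  by rewrite /seg_token /= -[_ * m]addn0 -im -divn_eq -ev.
split; first by rewrite mem_cat inE eqxx orbT.
by apply: quad_lt => //; lia.
Qed.

Variable kt : 'I_n -> seq nat.
Hypothesis ktP : sd_spec id (fun v => nbr_all (inp v)) (M ^ 4) tok_lab2 R kt.

Let toks v := [seq x %% M ^ 4 | x <- kt v].

Lemma mem_toks2 v x : x \in toks v <-> exists u, x \in tok_lab2 u.
Proof.
have [S C] := ktP; split=> [/mapP[y yk ->]|[u xu]].
  by have [u ul _] := S v y yk; exists u.
have [d uv dR] := ls_reach knP u v.
have [|d' _ yk] := C u v x d xu _ dR; first by rewrite (eq_walk (arc_nbr_all s t P irrE id_inj)).
apply/mapP; exists (d' * M ^ 4 + x) => //.
by have [_ lt] := tok_lab2_ok xu; rewrite modnMDl modn_small.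
Qed.

Lemma seg_quadE tag j i y : tag < 3 -> j < size lms -> i <= size P ->
  [/\ quad1 M (quad M tag (nth 0 lms j) (i %/ m) y) = tag,
      quad2 M (quad M tag (nth 0 lms j) (i %/ m) y) = nth 0 lms j,
      quad3 M (quad M tag (nth 0 lms j) (i %/ m) y) = i %/ m &
      quad4 M (quad M tag (nth 0 lms j) (i %/ m) y) = y].
Proof.
move=> tg jJ ih; have [u _ eu] := lms_nth jJ; apply: quadE; [lia | by rewrite eu |].
apply: leq_ltn_trans (leq_div _ _) _; have := P_lt; move: inf_lt; rewrite /inf; lia.
Qed.

Lemma quad_h : quad1 M (quad M 2 0 0 (size P)) = 2 /\ quad4 M (quad M 2 0 0 (size P)) = size P.
Proof. by have [|||-> _ _ ->] := @quadE M 2 0 0 (size P) => //; lia. Qed.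

Lemma path_lengthE v : path_length M (toks v) = size P.
Proof.
have [q1 q4] := quad_h; rewrite /path_length; set l := [seq quad4 M x | x <- _].
have l_h y : y \in l -> y = size P.
  move=> /mapP[x]; rewrite mem_filter => /andP[/eqP x2 /mem_toks2[u /tok_lab2P]] + ->.
  case=> [[i [j [ih _ _ [jJ _] ex]]]|[i [j [ih _ _ [jJ _] ex]]]|[_ ->]] //.
    by move: x2; rewrite ex; have [-> _ _ _] := seg_quadE (yA u j) (isT : 0 < 3) jJ ih.
  by move: x2; rewrite ex; have [-> _ _ _] := seg_quadE (yB u j) (isT : 1 < 3) jJ ih.
have : size P \in l.
  apply/mapP; exists (quad M 2 0 0 (size P)); last by rewrite q4.
  by rewrite mem_filter q1 /=; apply/mem_toks2; exists t; apply/tok_lab2P; constructor 3.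
by case: l l_h => // y l h _; apply: h; rewrite inE eqxx.
Qed.

Let FA v j := best_to M m (idx v) (toks v) (nth 0 lms j) (yA v j).
Let FB v j := best_from M m (idx v) (toks v) (nth 0 lms j) (cB v j).

Lemma FA_sound i j : i <= size P -> j < size lms -> FA (pvert i) j < INF ->
  exists a, [/\ a <= i, kn_to (kn (pvert a)) (nth 0 lms j) < n &
                FA (pvert i) j = a + kn_to (kn (pvert a)) (nth 0 lms j)].
Proof.
move=> ih jJ; rewrite /FA /best_to idx_pvert //.
case: (foldr_minn_cases (yA (pvert i) j)
        [seq quad4 M x | x <- toks (pvert i) & [&& quad1 M x == 0, quad2 M x == nth 0 lms j & quad3 M x < i %/ m]]).
  by move=> ->; apply: yA_sound.
move=> /mapP[x + ex]; rewrite ex mem_filter => /andP[/and3P[/eqP x1 /eqP x2 x3]].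
move=> /mem_toks2[v /tok_lab2P[]]; last first.
- by case=> _ e; move: x1; rewrite e; have [-> _] := quad_h.
- case=> [i' [j' [ih' _ _ [jJ' _] e]]]; move: x1; rewrite e.
  by have [-> _ _ _] := seg_quadE (yB v j') (isT : 1 < 3) jJ' ih'.
case=> [i' [j' [ih' ev _ [jJ' lt] e]]] _; move: x2 x3; rewrite e.
have [_ -> -> ->] := seg_quadE (yA v j') (isT : 0 < 3) jJ' ih' => ej lt_q.
rewrite ev in lt *; have [a [ai la ea]] := yA_sound ih' jJ' lt; rewrite ej in la ea.
exists a; split=> //; apply: leq_trans ai _; rewrite leqNgt; apply/negP => /ltnW.
by move/(leq_div2r m); rewrite leqNgt lt_q.
Qed.

Lemma FA_complete a i j : a <= i <= size P -> j < size lms ->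
  kn_to (kn (pvert a)) (nth 0 lms j) < n ->
  FA (pvert i) j <= a + kn_to (kn (pvert a)) (nth 0 lms j).
Proof.
move=> /andP[ai ih] jJ lt; rewrite /FA /best_to idx_pvert //.
have := leq_div2r m ai; rewrite leq_eqVlt => /predU1P[e|lt_q].
  by apply: leq_trans (foldr_minn_le_inf _ _) _; apply: yA_complete; rewrite ?ai.
(* The last vertex of the segment of [a]; it exists on [P] because [i] lies in a later segment. *)
pose i' := a %/ m * m + m.-1; have m0 := m_gt0.
have pm : m.-1 < m by rewrite prednK.
have e' : i' %/ m = a %/ m by rewrite /i' divnMDl // (divn_small pm) addn0.
have r' : i' %% m = m.-1 by rewrite /i' modnMDl modn_small.
have ai' : a <= i' by have := divn_eq a m; have := ltn_pmod a m0; rewrite /i'; lia.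
have ii' : i' <= i by rewrite leqNgt; apply/negP => /ltnW /(leq_div2r m); rewrite e' leqNgt lt_q.
have le : yA (pvert i') j <= a + kn_to (kn (pvert a)) (nth 0 lms j).
  by apply: yA_complete; rewrite ?ai' ?(leq_trans ii').
have ih' := leq_trans ii' ih; have Pn := P_lt.
apply: (leq_trans _ le); apply: foldr_minn_le; apply/mapP.
have [q1 q2 q3 q4] := seg_quadE (yA (pvert i') j) (isT : 0 < 3) jJ ih'.
exists (quad M 0 (nth 0 lms j) (i' %/ m) (yA (pvert i') j)); last by rewrite q4.
rewrite mem_filter q1 q2 q3 e' lt_q !eqxx; apply/mem_toks2; exists (pvert i').
apply/tok_lab2P; constructor 1; exists i', j; rewrite e'; split=> //.
by split=> //; apply: leq_ltn_trans le _; rewrite /inf; lia.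
Qed.

Lemma FB_sound i j : i <= size P -> j < size lms -> FB (pvert i) j < INF ->
  exists b, [/\ i < b <= size P, kn_from (kn (pvert b)) (nth 0 lms j) < n &
                FB (pvert i) j = n - b + kn_from (kn (pvert b)) (nth 0 lms j)].
Proof.
move=> ih jJ; rewrite /FB /best_from idx_pvert //.
case: (foldr_minn_cases (cB (pvert i) j)
        [seq quad4 M x | x <- toks (pvert i) & [&& quad1 M x == 1, quad2 M x == nth 0 lms j & i %/ m < quad3 M x]]).
  by move=> ->; apply: cB_sound.
move=> /mapP[x + ex]; rewrite ex mem_filter => /andP[/and3P[/eqP x1 /eqP x2 x3]].
move=> /mem_toks2[v /tok_lab2P[]]; last first.
- by case=> _ e; move: x1; rewrite e; have [-> _] := quad_h.
- case=> [i' [j' [ih' ev _ [jJ' lt] e]]] _; move: x2 x3; rewrite e.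
  have [_ -> -> ->] := seg_quadE (yB v j') (isT : 1 < 3) jJ' ih' => ej lt_q.
  rewrite ev in lt *; have [b [/andP[ib bh] lb eb]] := yB_sound ih' jJ' lt; rewrite ej in lb eb.
  exists b; split=> //; rewrite bh andbT; apply: leq_trans ib; rewrite ltnNge; apply/negP.
  by move/(leq_div2r m); rewrite leqNgt lt_q.
case=> [i' [j' [ih' _ _ [jJ' _] e]]]; move: x1; rewrite e.
by have [-> _ _ _] := seg_quadE (yA v j') (isT : 0 < 3) jJ' ih'.
Qed.

Lemma FB_complete b i j : i < b <= size P -> j < size lms ->
  kn_from (kn (pvert b)) (nth 0 lms j) < n ->
  FB (pvert i) j <= n - b + kn_from (kn (pvert b)) (nth 0 lms j).
Proof.
move=> /andP[ib bh] jJ lt; have ih : i <= size P by lia.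
rewrite /FB /best_from idx_pvert //.
have := leq_div2r m (ltnW ib); rewrite leq_eqVlt => /predU1P[e|lt_q].
  by apply: leq_trans (foldr_minn_le_inf _ _) _; apply: cB_complete; rewrite ?ib.
(* The first vertex of the segment of [b], present even if that segment is truncated. *)
pose i' := b %/ m * m; have m0 := m_gt0.
have e' : i' %/ m = b %/ m by rewrite /i' mulnK.
have r' : i' %% m = 0 by rewrite /i' modnMl.
have ib' : i' <= b by apply: leq_divM.
have le : yB (pvert i') j <= n - b + kn_from (kn (pvert b)) (nth 0 lms j).
  by apply: yB_complete; rewrite ?ib'.
have ih' := leq_trans ib' bh; have Pn := P_lt.
apply: (leq_trans _ le); apply: foldr_minn_le; apply/mapP.
have [q1 q2 q3 q4] := seg_quadE (yB (pvert i') j) (isT : 1 < 3) jJ ih'.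
exists (quad M 1 (nth 0 lms j) (i' %/ m) (yB (pvert i') j)); last by rewrite q4.
rewrite mem_filter q1 q2 q3 e' lt_q !eqxx; apply/mem_toks2; exists (pvert i').
apply/tok_lab2P; constructor 2; exists i', j; rewrite e'; split=> //.
by split=> //; apply: leq_ltn_trans le _; rewrite /inf; lia.
Qed.

Section Finish.

Variables (i short : nat).
Hypothesis ih : i < size P.
Hypothesis shortS : short < INF ->
  exists a b d, [/\ a <= i < b, b <= size P, walk offpath d (pvert a) (pvert b) & short = a + d + (n - b)].
Hypothesis shortC : forall a b d, a <= i < b -> b <= size P ->
  walk offpath d (pvert a) (pvert b) -> d <= m -> short <= a + d + (n - b).

Lemma finish_correct :
  repl_dist E s t (pvert i, pvert i.+1)
    (finish n M m (idx (pvert i)) lms short (yA (pvert i)) (cB (pvert i)) (toks (pvert i))).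
Proof.
rewrite /finish path_lengthE.
set best := best_cost _ _ _ _ _; have Pn := P_lt; have ih' := ltnW ih.
have -> : best = foldr minn short [seq FA (pvert i) j + FB (pvert i) j | j <- iota 0 (size lms) &
            (FA (pvert i) j < INF) && (FB (pvert i) j < INF)] by [].
set l := map _ _.
apply: (repl_distP shortest ih) => [c|a b d /andP[ai ib] bh wk].
  case: ifP => // lt [<-].
  have [a [b [d [aib bh wk ->]]]] : exists a b d, [/\ a <= i < b, b <= size P,
     walk offpath d (pvert a) (pvert b) & foldr minn short l = a + d + (n - b)].
    case: (foldr_minn_cases short l) => [e|/mapP[j]]; first by rewrite e in lt *; apply: shortS.
    rewrite mem_filter mem_iota add0n => /andP[/andP[ltA ltB] /andP[_ jJ]] ->.
    have [u uZ eu] := lms_nth jJ.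
    have [a [ai la ->]] := FA_sound ih' jJ ltA.
    have [b [/andP[ib bh] lb ->]] := FB_sound ih' jJ ltB.
    rewrite eu in la lb *.
    exists a, b, (kn_to (kn (pvert a)) (id u) + kn_from (kn (pvert b)) (id u)).
    rewrite ai ib; split=> //; last by lia.
    by apply: walkD; [apply: (ls_to_sound knP) | apply: (ls_from_sound knP)].
  by exists a, b, d; split=> //; lia.
(* Minimality gives [d' < n], which keeps the cost below [INF], and is what [Zhits] requires. *)
have [d' d'd wm] := wmin_exists wk; have d'n := wmin_lt wm; rewrite card_ord in d'n.
suff le : foldr minn short l <= a + d' + (n - b).
  have -> : foldr minn short l < INF by apply: leq_ltn_trans le _; rewrite /inf; lia.
  by eexists; first by []; lia.
case: (leqP d' m) => [d'm|md'].
  apply: leq_trans (foldr_minn_le_inf _ _) _.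
  by apply: shortC => //; [rewrite ai | case: wm].
have [u [d1 [d2 [uZ _ ed w1 w2]]]] := Zhits wm (ltnW md').
have [j jJ ej] : exists2 j, j < size lms & nth 0 lms j = id u.
  have : id u \in lms by apply/lmsP; exists u.
  by move=> ul; exists (index (id u) lms); rewrite ?index_mem ?nth_index.
have le1 := ls_to_complete knP uZ w1; have le2 := ls_from_complete knP uZ w2.
have lt1 : kn_to (kn (pvert a)) (nth 0 lms j) < n by rewrite ej; lia.
have lt2 : kn_from (kn (pvert b)) (nth 0 lms j) < n by rewrite ej; lia.
have leA : FA (pvert i) j <= a + d1.
  by apply: leq_trans (FA_complete _ jJ lt1) _; rewrite ?ai // ej leq_add2l.
have leB : FB (pvert i) j <= n - b + d2.
  by apply: leq_trans (FB_complete _ jJ lt2) _; rewrite ?ib // ej leq_add2l.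
apply: (@leq_trans (FA (pvert i) j + FB (pvert i) j)); last by lia.
apply: foldr_minn_le; apply/mapP; exists j => //.
rewrite mem_filter mem_iota jJ /= andbT; rewrite /inf; lia.
Qed.

End Finish.

End Scans.

Lemma runs_answer : exists x,
  runs E id B (m + (m.-1 + ((m + cap n) + ((m + cap n) + (R + (2 * (n %/ m).+1 * cap n + 1) + 0)))))
    (fun v => answer ie (inp v) (kn v)) x /\
  forall i, i < size P -> repl_dist E s t (pvert i, pvert i.+1) (x (pvert i)).
Proof.
have Mw : M ^ 4 <= 2 ^ w by apply: leq_trans MT; rewrite leq_pmulr // addnA addn1.
have Iw : INF < 2 ^ w.
  apply: leq_trans Mw; apply: leq_trans inf_lt _.
  by rewrite -[leqLHS]expn1 leq_exp2l //; lia.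
have nbA_adj v y : y \in nbA v -> exists2 u, uadj E v u & id u = y.
  by rewrite /nbA; case: ifP => // _; apply: prev_adj.
have nbB_adj v y : y \in nbB v -> exists2 u, uadj E v u & id u = y.
  by rewrite /nbB; case: ifP => // _; apply: next_adj.
have [zf runf zfP] := runs_pipe (E := E) (B := B) (nb := fun v => nbr_in 2 (inp v))
  id_inj (nbr_in_adj irrE (tag := 2))
  (fun v => detour_entry n (onp v) (idx v)) m wB Iw.
pose land v := land_entry n m (onp v) (idx v)
  (fun d => minn (detour_entry n (onp v) (idx v) d) (nth INF (zf v) d)).
have [zg rung zgP] := runs_pipe (E := E) (B := B) (nb := fun v => seq_of_opt (li_P_prev (inp v)))
  id_inj (prev_adj irrE id_inj shortest) land m.-1 wB Iw.
have [zA runA zAP] := runs_pipe (E := E) (B := B) (nb := nbA) id_inj nbA_adj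
  (fun v => scan_entry INF (size lms) (oA v) (vA v)) (m + cap n) wB Iw.
have [zB runB zBP] := runs_pipe (E := E) (B := B) (nb := nbB) id_inj nbB_adj
  (fun v => scan_entry INF (size lms) (oB v) (vB v)) (m + cap n) wB Iw.
pose yA v j := minn (vA v j) (nth INF (zA v) (oA v + j)).
pose yB v j := minn (vB v j) (nth INF (zB v) (oB v + j)).
have [||||kt runT ktP] := @runs_sd n E id B (fun v => nbr_all (inp v)) id_inj
   (nbr_all_adj irrE) (M ^ 4) (fun v => seg_tokens n M m (inp v) (idx v) lms (yA v) (yB v))
   (all_seg_tokens zA zB) R (R + (2 * (n %/ m).+1 * cap n + 1)) w.
- by move=> v l; apply: tok_lab2_ok.
- by rewrite leq_add2l size_all_seg_tokens.
- exact: wB.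
- exact: MT.
exists (fun v => finish n M m (idx v) lms (minn (land v m.-1) (nth INF (zg v) m.-1)) (yA v)
         (fun j => nth INF (zB v) (oB v + j)) [seq x %% M ^ 4 | x <- kt v]); split; last first.
  move=> i ih; apply: (finish_correct zAP zBP ktP ih).
    exact: (short_sound zfP zgP (ltnW ih)).
  by move=> a b d; apply: (short_complete zfP zgP).
have -> : (fun v => answer ie (inp v) (kn v)) = (fun v =>
  bind (pipe (nbr_in 2 (inp v)) INF (detour_entry n (onp v) (idx v)) m) (fun zf =>
  let land := land_entry n m (onp v) (idx v)
     (fun d => minn (detour_entry n (onp v) (idx v) d) (nth INF zf d)) in
  bind (pipe (seq_of_opt (li_P_prev (inp v))) INF land m.-1) (fun zg =>
  bind (pipe (nbA v) INF (scan_entry INF (size lms) (oA v) (vA v)) (m + cap n)) (fun zA =>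
  bind (pipe (nbB v) INF (scan_entry INF (size lms) (oB v) (vB v)) (m + cap n)) (fun zB =>
  let yA j := minn (vA v j) (nth INF zA (oA v + j)) in
  let yB j := minn (vB v j) (nth INF zB (oB v + j)) in
  bind (sd (nbr_all (inp v)) (M ^ 4) (R + (2 * (n %/ m).+1 * cap n + 1))
          (seg_tokens n M m (inp v) (idx v) lms yA yB)) (fun kt =>
  Ret (finish n M m (idx v) lms (minn (land m.-1) (nth INF zg m.-1)) yA
         (fun j => nth INF zB (oB v + j)) [seq x %% M ^ 4 | x <- kt]))))))).
  apply: functional_extensionality => v; rewrite /answer (ls_radius knP) kn_lms.
  by [].
apply: (runs_bind runf); apply: (runs_bind rung); apply: (runs_bind runA).
by apply: (runs_bind runB); apply: (runs_bind runT).
Qed.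

End Answer.

(** * Round and bandwidth bounds *)

Definition rpaths ie (I : local_input) (bits : seq bool) : prog (option nat) :=
  bind (learn ie I bits) (answer ie I).

Section Bounds.

Variable n : nat.
Hypothesis n_gt1 : 1 < n.

Let C := cbrt_up (n ^ 2).
Let x := 2 ^ srate n.
Let L := lg n.

Lemma lg_bounds : 1 < L /\ n < 2 ^ L /\ L < 2 ^ L.
Proof.
split; last by split; [apply: trunc_log_ltn | apply: ltn_expl].
by rewrite /L /lg ltnS trunc_log_gt0.
Qed.

Lemma cbrt_bounds : [/\ 0 < C, C <= n ^ 2 & n ^ 2 <= C ^ 3].
Proof.
pose p y := n ^ 2 <= y ^ 3.
have pn : p (n ^ 2) by rewrite /p -expnM leq_exp2l.
have [h1 h2] := find_iota p (n ^ 2).+1.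
have le : C <= n ^ 2 by apply: h2.
have pC : p C by apply: h1; rewrite ltnS.
split=> //; rewrite lt0n; apply: contraTneq pC => ->.
by rewrite /p exp0n // leqn0 expn_eq0; lia.
Qed.

Lemma rate_bounds : [/\ 0 < x, x <= C & C < 2 * x].
Proof.
have [C0 _ _] := cbrt_bounds; rewrite /x /srate expn_gt0 -expnS.
by split=> //; [apply: trunc_logP | apply: trunc_log_ltn].
Qed.

(** From n^2 <= C^3 < C (2x)^2: the number of pairs of landmarks is of order n^(2/3), up to
    logarithms. *)
Lemma quot_bound : (n %/ x) ^ 2 <= 4 * C.
Proof.
have [x0 xC Cx] := rate_bounds; have [C0 _ nC] := cbrt_bounds.
have x2 : 0 < x ^ 2 by rewrite expn_gt0 x0.
rewrite -(leq_pmul2r x2) -expnMn; apply: (@leq_trans (n ^ 2)).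
  by rewrite leq_exp2r //; apply: leq_divM.
apply: leq_trans nC _; rewrite [C ^ 3]expnS mulnAC mulnC leq_mul2r.
apply/orP; right; apply: (@leq_trans ((2 * x) ^ 2)); last by rewrite expnMn.
by rewrite leq_exp2r // ltnW.
Qed.

Lemma poly_bounds : 3 * n + (hops n + cap n) + (3 * cap n * cap n + 1) <= 2 ^ (9 * L) /\
  3 * n + (2 * (n %/ hops n).+1 * cap n + 1) <= 2 ^ (9 * L).
Proof.
have [L1 [nL LL]] := lg_bounds; have [x0 xC Cx] := rate_bounds; have [C0 Cn nC] := cbrt_bounds.
have -> : 2 ^ (9 * L) = (2 ^ L) ^ 9 by rewrite mulnC expnM.
set N := 2 ^ L in nL LL *.
have N4 : 4 <= N by rewrite (@leq_exp2l 2 2 L).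
have xN : x <= N * N by apply: leq_trans xC (leq_trans Cn _); rewrite expnS expn1 leq_mul // ltnW.
have hN : hops n <= 3 * (N * N * N).
  have -> : 3 * (N * N * N) = (N * N) * (3 * N) by lia.
  by apply: leq_mul => //; rewrite -/L; lia.
have cN : cap n <= 3 * N.
  by rewrite /cap -/x -/L; have := leq_div n x; lia.
have cc : cap n * cap n <= 9 * (N * N) by have := leq_mul cN cN; lia.
have dN : (n %/ hops n).+1 <= N by have := leq_div n (hops n); lia.
have dc : (n %/ hops n).+1 * cap n <= 3 * (N * N) by have := leq_mul dN cN; lia.
have NN : N <= N * N by apply: leq_pmulr; lia.
have NNN : N * N <= N * N * N by apply: leq_pmulr; lia.
have N9 : 64 * (N * N * N) <= N ^ 9.
  have -> : N ^ 9 = N ^ 6 * (N * N * N) by rewrite !expnS; lia.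
  rewrite leq_mul2r; apply/orP; right; apply: (@leq_trans (4 ^ 6)) => //.
  by rewrite leq_exp2r.
by split; apply: leq_trans N9; lia.
Qed.

Lemma round_bound D R : R <= 3 * D.+1 ->
  R + 3 * (hops n + cap n) + (R + (3 * cap n * cap n + 1)) +
  (hops n + ((hops n).-1 + ((hops n + cap n) + ((hops n + cap n) +
    (R + (2 * (n %/ hops n).+1 * cap n + 1) + 0))))) <= 1000 * (C + D) * L ^ 2.
Proof.
move=> RD; have [L1 [nL LL]] := lg_bounds; have [x0 xC Cx] := rate_bounds.
have [C0 Cn nC] := cbrt_bounds; have qb := quot_bound.
have hC : hops n <= 6 * (C * L).
  have -> : 6 * (C * L) = C * (6 * L) by lia.
  by apply: leq_mul => //; rewrite -/L; lia.
set q := n %/ x in qb; have eq : cap n = 2 * q.+1 + L + 1 by [].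
have dq : n %/ hops n <= q by rewrite /hops -/x divnMA; apply: leq_div.
(* Splits mixed products into squares, which are controlled by [C] or by [L * L]. *)
have agm y z : 2 * (y * z) <= y * y + z * z by have := (nat_Cauchy y z).1; rewrite !mulnn.
have q2 : q.+1 * q.+1 <= 10 * C by have := agm q 1; rewrite expnS expn1 in qb; lia.
set c := cap n in eq *; set h := hops n in hC dq *; set d := n %/ h in dq *.
have LLL : L * L = L ^ 2 by rewrite expnS expn1.
rewrite -LLL; have CL : C * L <= C * (L * L) by rewrite leq_mul2l leq_pmulr ?orbT //; lia.
have C1 : C <= C * L by apply: leq_pmulr; lia.
have L2 : L * L <= C * (L * L) by apply: leq_pmull.
have D2 : D <= D * (L * L) by apply: leq_pmulr; rewrite muln_gt0; lia.
have c2 : c * c <= 88 * (C * (L * L)).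
  have le : c <= 2 * q.+1 + 2 * L by lia.
  by have := leq_mul le le; have := agm q.+1 L; lia.
have cc : c <= c * c by apply: leq_pmulr; rewrite eq; lia.
have dc : d.+1 * c <= q.+1 * q.+1 + c * c.
  have : d.+1 * c <= q.+1 * c by rewrite leq_mul2r ltnS dq orbT.
  by have := agm q.+1 c; lia.
have -> : 1000 * (C + D) * (L * L) = 1000 * (C * (L * L)) + 1000 * (D * (L * L)) by lia.
lia.
Qed.

End Bounds.

Lemma wmin_depth n (Q : rel 'I_n) d u v : wmin Q d u v -> find (fun d => walk Q d u v) (iota 0 n) = d.
Proof.
move=> wm; have dn := wmin_lt wm; rewrite card_ord in dn.
have [h1 h2] := find_iota (fun d => walk Q d u v) n.
have le := h2 d dn (proj1 wm); apply/eqP; rewrite eqn_leq le.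
by apply: (proj2 wm); apply: h1; apply: leq_ltn_trans le dn.
Qed.

(* Taking all shortest walks together avoids the choice of a canonical one. *)
Definition early n (Q : rel 'I_n) m (u v : 'I_n) : {set 'I_n} :=
  [set w | [exists d1 : 'I_n, [exists d2 : 'I_n,
     [&& 0 < d1 <= m, walk Q d1 u w, walk Q d2 w v & [forall d : 'I_n, walk Q d u v ==> (d1 + d2 <= d)]]]]].

(** The vertices at depths 1 to [m] of one shortest walk belong to the set, and their distances from
    [u] tell them apart. *)
Lemma card_early n (Q : rel 'I_n) m u v d : wmin Q d u v -> m <= d -> m <= #|early Q m u v|.
Proof.
move=> wm md; have dn := wmin_lt wm; rewrite card_ord in dn.
pose depth w := find (fun d => walk Q d u w) (iota 0 n).
rewrite -[m in m <= _](size_iota 1) -(size_image depth); apply: uniq_leq_size (iota_uniq _ _) _.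
move=> i; rewrite mem_iota => im; have id : i <= d by lia.
have := wm; rewrite -(subnKC id) => wm'; have [w w1 w2] := walk_split (proj1 wm').
have [m1 _] := wmin_splitl wm' w1 w2.
apply/imageP; exists w; last by rewrite /depth (wmin_depth m1).
have ltn : i < n by lia.
have ltd : d - i < n by lia.
rewrite inE; apply/existsP; exists (Ordinal ltn); apply/existsP; exists (Ordinal ltd).
rewrite /= w1 w2 /=; apply/andP; split; first lia.
by apply/forallP => d'; apply/implyP => /(proj2 wm); rewrite subnKC.
Qed.

Lemma early_hits n (Q : rel 'I_n) (Z : {set 'I_n}) m :
  (forall u v, m <= #|early Q m u v| -> exists2 w, w \in early Q m u v & w \in Z) -> hits Q Z m.
Proof.
move=> h u v d wm md; have [w + wZ] := h u v (card_early wm md).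
rewrite inE => /existsP[d1 /existsP[d2 /and4P[d1m w1 w2 /forallP mn]]].
exists w, d1, d2; split=> //; apply/eqP; rewrite eqn_leq.
have dn := wmin_lt wm; rewrite card_ord in dn.
have /implyP/(_ (proj1 wm)) -> := mn (Ordinal dn).
by apply: (proj2 wm); apply: walkD w1 w2.
Qed.

Lemma card_all_false b : #|[pred z : b.-tuple bool | all negb z]| = 1.
Proof.
rewrite (@eq_card1 _ [tuple false | i < b]) // => z; rewrite !inE.
apply/idP/eqP => [/all_tnthP h|->]; last by apply/all_tnthP => i; rewrite tnth_mktuple.
by apply: eq_from_tnth => i; rewrite tnth_mktuple; apply/negbTE/h.
Qed.

Theorem theorem1p1 :
  forall idexp : nat,
  exists (A : congest_alg) (cB a k c : nat),
    0 < c /\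
    forall (n : nat) (E : rel 'I_n) (id : 'I_n -> nat) (s t : 'I_n) (P : seq 'I_n) (D : nat),
      irreflexive E ->
      injective id ->
      (forall v, id v < n ^ idexp) ->
      is_shortest_path E s P t ->
      udiam_le E D ->
      let B := cB * (trunc_log 2 n).+1 in
      let T := a * (cbrt_up (n ^ 2) + D) * (trunc_log 2 n).+1 ^ k in
      exists Good : {set {ffun 'I_n -> (rbits A n).-tuple bool}},
        #|~: Good| * n ^ c <= #|{ffun 'I_n -> (rbits A n).-tuple bool}| /\
        forall rnd, rnd \in Good ->
          forall i, i < size P ->
            exists d,
              repl_dist E s t (nth s (s :: P) i, nth s (s :: P) i.+1) d /\
              decided_by A E id (local_inputs E id s t P) (fun v => val (rnd v)) B T
                (nth s (s :: P) i) d.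
Proof.
(* A key has [w = (4 * (ie + 3) + 9) * L] bits: four digits in base [M] and, by [poly_bounds],
   [9 * L] bits for a number of rounds. Its encoding takes [2 * w + 1] bits. *)
move=> ie; exists (prog_alg srate (rpaths ie)), (2 * (4 * (ie + 3) + 9)).+1, 1000, 2, 1.
split=> // n E id s t P D irrE id_inj id_lt shortest diam B T.
case: (posnP (size P)) => [P0|P0].
  exists setT; rewrite setCT cards0; split=> // rnd _ i; by rewrite P0.
have Pn := P_lt shortest.
have n_gt1 : 1 < n by apply: leq_ltn_trans Pn.
have [L1 [nL LL]] := lg_bounds n_gt1; have [pb1 pb2] := poly_bounds n_gt1.
have [x0 xC Cx] := rate_bounds n_gt1.
pose x := 2 ^ srate n; pose L := lg n; pose N := 2 ^ L.
have N4 : 4 <= N by rewrite (@leq_exp2l 2 2 L).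
have M_N3 : N * (N * N) <= base ie n.
  have -> : N * (N * N) = 2 ^ (3 * L) by rewrite /N -!expnD; congr (2 ^ _); lia.
  by rewrite /base leq_exp2l // leq_mul2r leq_addl orbT.
have NN : N * 4 <= N * (N * N) by rewrite leq_mul2l; nia.
have M_gt : 3 < base ie n by lia.
have n_lt : n < base ie n by rewrite -/N in nL; lia.
have inf_lt : inf n < base ie n by rewrite -/N in nL; rewrite /inf; lia.
have id_base v : id v < base ie n.
  apply: leq_trans (id_lt v) _; apply: (@leq_trans (N ^ ie)); first by case: (ie) => // e; rewrite leq_exp2r // ltnW.
  by rewrite /base /N -expnM leq_exp2l // mulnC leq_mul2r leq_addr orbT.
pose w := (4 * (ie + 3) + 9) * L.
have wB : (2 * w).+1 <= B.
  have : 0 < L by []; rewrite /B -/(lg n) -/L /w; nia.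
have pw y : y <= 2 ^ (9 * L) -> base ie n ^ 4 * y <= 2 ^ w.
  move=> ly; rewrite /w mulnDl expnD -mulnA [4 * _]mulnC expnM leq_mul //.
pose rt := fun (tag : 'I_3) => tag_rel E s P tag.
pose fam (p : 'I_3 * 'I_n * 'I_n) := early (rt p.1.1) (hops n) p.1.2 p.2.
have cT : #|{: (srate n).-tuple bool}| = x by rewrite card_tuple card_bool.
have [||||Good [cardG GoodP]] := @sampling_good n _ _ (card_all_false (srate n)) _ fam
    (n %/ x).+1 (3 * L + 3) (cap n).
- rewrite cT /x; apply: expn_succ_le; first by rewrite expn_gt0.
  case: (srate n) => [|b]; [by left | by right; exists (2 ^ b); rewrite expnS].
- by rewrite cT mulnC; apply: ltnW; apply: ltn_ceil.
- have -> : 2 ^ (3 * L + 3) = 8 * (N * N * N) by rewrite expnD mulnC [3 * L]mulnC expnM -/N [N ^ 3]expnSr mulnn.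
  rewrite !card_prod !card_ord; have nN := ltnW nL.
  by have := leq_mul (leq_mul nN nN) nN; rewrite -/N; lia.
- have -> : cap n = 2 * (n %/ x).+1 + L.+1 by rewrite /cap -/x -/L; lia.
  by rewrite expnD expnM leq_mul2l expnS; apply/orP; right; rewrite leq_mul2l ltnW.
rewrite cT in cardG GoodP.
exists Good; split; first by rewrite expn1 card_ffun card_ord cT.
move=> rnd /GoodP[few hit].
pose bits v := val (rnd v).
have Zcap : #|Z E id s t P bits| <= cap n.
  apply: leq_trans few; rewrite -add1n -(cards1 s) (leq_trans _ (leq_card_setU _ _)) //.
  apply: subset_leq_card; apply/subsetP => v; rewrite !inE /landmark => /orP[/= /eqP->|].
    by rewrite eqxx.
  by move=> ->; rewrite orbT.
have Zhits tag : tag < 3 -> hits (tag_rel E s P tag) (Z E id s t P bits) (hops n).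
  move=> tg; apply: early_hits => u v le.
  have [|y yf yz] := hit (Ordinal tg, u, v); first exact: le.
  by exists y => //; rewrite inE /landmark; apply/orP; right.
have [kn [R [T1 [run1 knP RD Rn T1le]]]] := @runs_learn ie n E id s t P D B irrE id_inj shortest diam
  bits id_base n_lt M_gt Zcap Zhits w wB (pw _ pb1).
have [lms [kn_lms lms_cap lmsP]] := ls_landmarks knP.
have [|y [run2 yP]] := @runs_answer ie n E id s t P B irrE id_inj shortest P0 bits kn R knP id_base
  inf_lt M_gt (Zhits 1 isT) lms kn_lms lms_cap lmsP w wB.
  by apply: pw; apply: leq_trans pb2; rewrite leq_add2r.
move=> i ih; exists (y (nth s (s :: P) i)); split; first exact: yP.
have run : runs E id B _ (fun v => rpaths ie (local_inputs E id s t P v) (bits v)) y :=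
  runs_bind (f := fun v => answer ie (local_inputs E id s t P v)) run1 run2.
apply: (runs_decided srate (inp := local_inputs E id s t P) (rnd := bits) _ run).
by apply: leq_trans (round_bound n_gt1 RD); rewrite leq_add2r.
Qed.
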